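(* Let $0<\varepsilon<1/2$, $x_0\in[\varepsilon,1-\varepsilon]$, $\varphi=\arccos x_0$. Let $\sigma,\tau\in\mathbb{R}$ and let $u,v\in S^2$, the space of pure unit quaternions. Define $$s_n=2\sqrt{n+3/2}\,\cos\Bigl(\varphi+\frac{\sigma}{2\sin^2\varphi}\frac1n\Bigr),\qquad t_n=2\sqrt{n+3/2}\,\cos\Bigl(\varphi+\frac{\tau}{2\sin^2\varphi}\frac1n\Bigr)$$ and $$\mathcal{K}_n\bigl((u,\sigma),(v,\tau);x_0\bigr)=\frac{2\sqrt{n+\frac32}}{\rho(x_0)}\,K_n(us_n,vt_n)\,\sqrt{f(s_n)f(t_n)}.$$ Then $$\lim_{n\to\infty}\mathcal{K}_n\bigl((u,\sigma),(v,\tau);x_0\bigr)=\frac{\sin(\tau-\sigma)}{\tau-\sigma}\,\frac{1-uv}{2}.$$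
   Context: $\mathbb{H}$ denotes the real quaternions; $\Lambda\subset\mathbb{H}$ is the set of pure (imaginary) quaternions $z=x_1\mathbf i+x_2\mathbf j+x_3\mathbf k$, identified with $\mathbb{R}^3$. The measure on $\Lambda$ is $d\mu(z)=f(z)\,dm(z)$, $f(z)=(2\pi)^{-3/2}e^{-|z|^2/2}$, with $m$ Lebesgue measure on $\mathbb{R}^3$; for real $s$ we write $f(s)=(2\pi)^{-3/2}e^{-s^2/2}$. Polynomials are functions on $\Lambda$ of the form $P(z)=\sum_{k=0}^N z^ka_k$, $a_k\in\mathbb{H}$, with scalar product $\langle u,w\rangle=\int_\Lambda \overline{u(z)}w(z)\,d\mu(z)$. $P_n$ ($n\ge0$) denotes the (unique) system of monic polynomials (leading term $z^n$) with $\langle P_k,P_l\rangle=0$ for $k\ne l$, and $h_n=\langle P_n,P_n\rangle$. The kernel is $K_n(x,y)=\sum_{k=0}^{n}P_k(x)\overline{P_k(y)}/h_k$. For $s\in(0,1)$, $\rho(s)=\dfrac{1}{(2\pi)^2}\dfrac{\sqrt{1-s^2}}{s^2}$. The expression $\sin(\tau-\sigma)/(\tau-\sigma)$ is read as $1$ when $\sigma=\tau$. The product $uv$ is the quaternion product. *)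

(* Defs.v *)
From HB Require Import structures.
From mathcomp Require Import all_boot all_order all_algebra.
From mathcomp Require Import ring lra.
From mathcomp Require Import all_classical all_reals all_analysis.

Set Implicit Arguments.
Unset Strict Implicit.
Unset Printing Implicit Defensive.

Import Order.TTheory GRing.Theory Num.Theory.
Import numFieldNormedType.Exports.

Local Open Scope classical_set_scope.
Local Open Scope ring_scope.

(** [Quat a b c d] is the real quaternion [a + b i + c j + d k]. *)
Record quat (R : Type) : Type := Quat { qre : R; qi : R; qj : R; qk : R }.

Section QuatChoice.
Variable R : Type.

Definition quat_tuple (x : quat R) : R * R * R * R :=
  (qre x, qi x, qj x, qk x).
Definition tuple_quat (t : R * R * R * R) : quat R :=
  Quat t.1.1.1 t.1.1.2 t.1.2 t.2.

Lemma quat_tupleK : cancel quat_tuple tuple_quat.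
Proof. by case. Qed.

End QuatChoice.

HB.instance Definition _ (R : choiceType) :=
  Choice.copy (quat R) (can_type (@quat_tupleK R)).

Section QuatAlgebra.
Variable R : realType.
Implicit Types (x y z : quat R) (a : R).

Definition quat0 : quat R := Quat 0 0 0 0.
Definition quatN x := Quat (- qre x) (- qi x) (- qj x) (- qk x).
Definition quatD x y :=
  Quat (qre x + qre y) (qi x + qi y) (qj x + qj y) (qk x + qk y).

Lemma quat_addA : associative quatD.
Proof. by move=> [a b c d] [e f g h] [i j k l]; congr Quat => /=; ring. Qed.
Lemma quat_addC : commutative quatD.
Proof. by move=> [a b c d] [e f g h]; congr Quat => /=; ring. Qed.
Lemma quat_add0 : left_id quat0 quatD.
Proof. by move=> [a b c d]; congr Quat => /=; ring. Qed.
Lemma quat_addN : left_inverse quat0 quatN quatD.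
Proof. by move=> [a b c d]; congr Quat => /=; ring. Qed.

HB.instance Definition _ :=
  GRing.isZmodule.Build (quat R) quat_addA quat_addC quat_add0 quat_addN.

Definition quat1 : quat R := Quat 1 0 0 0.
Definition quatM x y := Quat
  (qre x * qre y - qi x * qi y - qj x * qj y - qk x * qk y)
  (qre x * qi y + qi x * qre y + qj x * qk y - qk x * qj y)
  (qre x * qj y - qi x * qk y + qj x * qre y + qk x * qi y)
  (qre x * qk y + qi x * qj y - qj x * qi y + qk x * qre y).

Lemma quat_mulA : associative quatM.
Proof. by move=> [a b c d] [e f g h] [i j k l]; congr Quat => /=; ring. Qed.
Lemma quat_mul1 : left_id quat1 quatM.
Proof. by move=> [a b c d]; congr Quat => /=; ring. Qed.
Lemma quat_mulr1 : right_id quat1 quatM.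
Proof. by move=> [a b c d]; congr Quat => /=; ring. Qed.
Lemma quat_mulDl : left_distributive quatM +%R.
Proof. by move=> [a b c d] [e f g h] [i j k l]; congr Quat => /=; ring. Qed.
Lemma quat_mulDr : right_distributive quatM +%R.
Proof. by move=> [a b c d] [e f g h] [i j k l]; congr Quat => /=; ring. Qed.
Lemma quat_1neq0 : quat1 != 0.
Proof. by apply/eqP => -[] /eqP; rewrite oner_eq0. Qed.

HB.instance Definition _ := GRing.Zmodule_isNzRing.Build (quat R)
  quat_mulA quat_mul1 quat_mulr1 quat_mulDl quat_mulDr quat_1neq0.

Definition quatZ a x := Quat (a * qre x) (a * qi x) (a * qj x) (a * qk x).

Lemma quat_scaleA a b x : quatZ a (quatZ b x) = quatZ (a * b) x.
Proof. by case: x => *; congr Quat => /=; ring. Qed.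
Lemma quat_scale1 : left_id 1 quatZ.
Proof. by move=> [a b c d]; congr Quat => /=; ring. Qed.
Lemma quat_scaleDr : right_distributive quatZ +%R.
Proof. by move=> r [a b c d] [e f g h]; congr Quat => /=; ring. Qed.
Lemma quat_scaleDl x : {morph quatZ^~ x : a b / a + b}.
Proof. by move=> a b; case: x => *; congr Quat => /=; ring. Qed.

HB.instance Definition _ := GRing.Zmodule_isLmodule.Build R (quat R)
  quat_scaleA quat_scale1 quat_scaleDr quat_scaleDl.

Lemma quat_scaleAl a x y : a *: (x * y) = (a *: x) * y.
Proof. by case: x y => ? ? ? ? [*]; congr Quat => /=; ring. Qed.

HB.instance Definition _ :=
  GRing.Lmodule_isLalgebra.Build R (quat R) quat_scaleAl.

Lemma quat_scaleAr a x y : a *: (x * y) = x * (a *: y).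
Proof. by case: x y => ? ? ? ? [*]; congr Quat => /=; ring. Qed.

HB.instance Definition _ :=
  GRing.Lalgebra_isAlgebra.Build R (quat R) quat_scaleAr.

Definition qconj x := Quat (qre x) (- qi x) (- qj x) (- qk x).

Definition qsqnorm x := qre x ^+ 2 + qi x ^+ 2 + qj x ^+ 2 + qk x ^+ 2.

Lemma qsqnorm_ge0 x : 0 <= qsqnorm x.
Proof. by rewrite /qsqnorm !addr_ge0// sqr_ge0. Qed.

Lemma qsqnorm_eq0 x : (qsqnorm x == 0) = (x == 0).
Proof.
apply/idP/eqP => [|->]; last by rewrite /qsqnorm /= !expr0n /= !addr0.
case: x => a b c d; rewrite /qsqnorm /=.
rewrite paddr_eq0 ?addr_ge0 ?sqr_ge0// paddr_eq0 ?addr_ge0 ?sqr_ge0//.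
rewrite paddr_eq0 ?sqr_ge0// !sqrf_eq0.
by move=> /andP[/andP[/andP[/eqP-> /eqP->] /eqP->] /eqP->].
Qed.

Definition quatV x := if x == 0 then x else (qsqnorm x)^-1 *: qconj x.

Lemma quat_mulV : {in [pred x : quat R | x != 0],
  left_inverse 1 quatV *%R}.
Proof.
move=> x /= x0; rewrite /quatV (negbTE x0).
have : qsqnorm x != 0 by rewrite qsqnorm_eq0.
case: x x0 => a b c d _; rewrite /qsqnorm /= => n0.
by congr Quat => /=; field.
Qed.

Lemma quat_divv : {in [pred x : quat R | x != 0],
  right_inverse 1 quatV *%R}.
Proof.
move=> x /= x0; rewrite /quatV (negbTE x0).
have : qsqnorm x != 0 by rewrite qsqnorm_eq0.
case: x x0 => a b c d _; rewrite /qsqnorm /= => n0.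
by congr Quat => /=; field.
Qed.

Lemma quat_unitP x y : y * x = 1 /\ x * y = 1 -> x != 0.
Proof.
move=> [yx1 _]; apply/eqP => x0; move: yx1; rewrite x0 mulr0.
by move/eqP; rewrite eq_sym oner_eq0.
Qed.

Lemma quat_inv_out : {in [predC [pred x : quat R | x != 0]], quatV =1 id}.
Proof. by move=> x; rewrite !inE negbK /quatV => ->. Qed.

HB.instance Definition _ := GRing.NzRing_hasMulInverse.Build (quat R)
  quat_mulV quat_divv quat_unitP quat_inv_out.

Definition qnorm x : R := Num.sqrt (qsqnorm x).

Lemma qnormD x y : qnorm (x + y) <= qnorm x + qnorm y.
Proof.
rewrite -(@ler_pXn2r _ 2)// ?nnegrE ?addr_ge0 ?sqrtr_ge0//.
rewrite sqrrD !sqr_sqrtr ?qsqnorm_ge0//.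
rewrite -sqrtrM ?qsqnorm_ge0//.
pose p := qre x * qre y + qi x * qi y + qj x * qj y + qk x * qk y.
have -> : qsqnorm (x + y) = qsqnorm x + p *+ 2 + qsqnorm y.
  by rewrite /qsqnorm /p /=; ring.
rewrite lerD2r lerD2l lerMn2r /=.
apply: (le_trans (ler_norm p)); rewrite -sqrtr_sqr ler_wsqrtr//.
rewrite -subr_ge0.
have -> : qsqnorm x * qsqnorm y - p ^+ 2 =
  (qre x * qi y - qi x * qre y) ^+ 2 + (qre x * qj y - qj x * qre y) ^+ 2 +
  (qre x * qk y - qk x * qre y) ^+ 2 + (qi x * qj y - qj x * qi y) ^+ 2 +
  (qi x * qk y - qk x * qi y) ^+ 2 + (qj x * qk y - qk x * qj y) ^+ 2.
  by rewrite /qsqnorm /p; ring.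
by rewrite !addr_ge0// sqr_ge0.
Qed.

Lemma qnormZ a x : qnorm (a *: x) = `|a| * qnorm x.
Proof.
have -> : qnorm (a *: x) = Num.sqrt (a ^+ 2 * qsqnorm x).
  by congr Num.sqrt; rewrite /qsqnorm /=; ring.
by rewrite sqrtrM ?sqr_ge0// sqrtr_sqr.
Qed.

Lemma qnorm_eq0 x : qnorm x = 0 -> x = 0.
Proof.
move=> /eqP; rewrite sqrtr_eq0 => x0; apply/eqP.
by rewrite -qsqnorm_eq0 eq_le x0 qsqnorm_ge0.
Qed.

(** From now on [`|x|] is the Euclidean norm of the quaternion [x], and limits
    in [quat R] are taken for this norm. *)
HB.instance Definition _ :=
  Lmodule_isNormed.Build R (quat R) qnormD qnormZ qnorm_eq0.

End QuatAlgebra.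

Section QuaternionicKernel.
Variable R : realType.

Definition pureq (x : R * R * R) : quat R := Quat 0 x.1.1 x.1.2 x.2.

(** Pure unit quaternions. *)
Definition S2 : set (quat R) := [set u | qre u = 0 /\ `|u| = 1].

Definition leb3 := ((@lebesgue_measure R \x @lebesgue_measure R)
                     \x @lebesgue_measure R)%E.

Definition fgauss (s : R) : R :=
  (2 * pi) `^ (- (3 / 2)) * expR (- (s ^+ 2) / 2).

(** Integral over the pure quaternions of a quaternion-valued function, taken
    componentwise, for the measure with density [z |-> fgauss `|z|]. *)
Definition qint (g : quat R -> quat R) : quat R :=
  let G x := fgauss `|pureq x| *: g (pureq x) in
  Quat (\int[leb3]_x qre (G x)) (\int[leb3]_x qi (G x))
       (\int[leb3]_x qj (G x)) (\int[leb3]_x qk (G x)).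

Definition qinner (u w : quat R -> quat R) : quat R :=
  qint (fun z => qconj (u z) * w z).

(** Evaluation with coefficients on the right of the powers of the variable;
    [p.[z]] from the library would put them on the left. *)
Definition peval (p : {poly quat R}) (z : quat R) : quat R :=
  \sum_(k < size p) z ^+ k * p`_k.

Definition monic_orthogonal (P : nat -> {poly quat R}) : Prop :=
  (forall n, P n \is monic /\ size (P n) = n.+1) /\
  (forall k l, k <> l -> qinner (peval (P k)) (peval (P l)) = 0).

Definition sqnorm_of (P : nat -> {poly quat R}) (n : nat) : quat R :=
  qinner (peval (P n)) (peval (P n)).

Definition qkernel (P : nat -> {poly quat R}) (n : nat) (x y : quat R) :
    quat R :=
  \sum_(k < n.+1) peval (P k) x * qconj (peval (P k) y) / sqnorm_of P k.

Definition rho (s : R) : R :=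
  1 / (2 * pi) ^+ 2 * (Num.sqrt (1 - s ^+ 2) / s ^+ 2).

(** [s_n] for [theta = sigma], [t_n] for [theta = tau]. *)
Definition scaled_point (x0 theta : R) (n : nat) : R :=
  let phi := acos x0 in
  2 * Num.sqrt (n%:R + 3 / 2) *
  cos (phi + theta / (2 * sin phi ^+ 2) * (1 / n%:R)).

Definition rescaled_kernel (P : nat -> {poly quat R}) (n : nat)
    (u : quat R) (sigma : R) (v : quat R) (tau : R) (x0 : R) : quat R :=
  let s := scaled_point x0 sigma n in
  let t := scaled_point x0 tau n in
  (2 * Num.sqrt (n%:R + 3 / 2) / rho x0 * Num.sqrt (fgauss s * fgauss t)) *:
  qkernel P n (s *: u) (t *: v).

Definition sinc (x : R) : R := if x == 0 then 1 else sin x / x.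

End QuaternionicKernel.

(* Main.v *)
Require Import Defs.
From HB Require Import structures.
From mathcomp Require Import all_boot all_order all_algebra.
From mathcomp Require Import ring lra zify.
From mathcomp Require Import all_classical all_reals all_analysis.
From mathcomp Require Import measurable_realfun normal_distribution.
From mathcomp Require Import lebesgue_integral_differentiation.

Import Order.TTheory GRing.Theory Num.Theory.
Import numFieldNormedType.Exports.

Local Open Scope classical_set_scope.
Local Open Scope ring_scope.

Set Implicit Arguments.
Unset Strict Implicit.
Unset Printing Implicit Defensive.

(** The orthogonal polynomials satisfy [P_(n+1) = z P_n + gam_n P_(n-1)] with [gam_n = n] for even
    [n] and [n + 2] for odd [n]. On a line [R u] of pure quaternions [P_n (s u)] is therefore
    [p_n(s) u^n] with real [p_n], and [p_n] is expressed by the Hermite polynomials [He_(n+1)],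
    [He_n] divided by [s] or [s^2]. Splitting the sum by the parity of [k], the quaternionic kernel
    becomes [E - O uv], where [s t E] and [s t O] are, up to one boundary term, half the difference
    and half the sum of the Hermite kernel at [(s, t)] and at [(s, -t)].

    The Hermite kernel is treated through the Christoffel-Darboux formula, and the Hermite functions
    by the substitution [x = 2 sqrt(nu) cos theta], [nu = N + 1/2]: they solve a first order system
    with frequency of order [nu], whose energy converges at [theta = pi/2] (Wallis) and is an
    adiabatic invariant away from [theta = 0]. On the scale [1/nu] the system is a rotation, so that the
    Wronskian in the formula converges to a sine at [(s, t)]. At [(s, -t)] the factor [s + t] in the
    denominator is of order [sqrt(nu)] and the kernel is negligible. *)

(** * Hermite polynomials and their kernel *)

Section Hermite.
Context {R : realType}.
Implicit Types (n k : nat) (x s t : R).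

(** The scaling is dictated by the Hermite equation. The kernel of degree [n] involves Hermite
    polynomials up to degree [N = n + 1], hence [nu = N + 1/2 = n + 3/2]. In the angle the local
    frequency is [2 nu sin^2 phi], so that a shift [tau / (2 sin^2 phi n)] is asymptotically a phase
    [tau]. The phase of a Hermite function at a given angle is never determined. The kernel only
    sees the energy and the phase difference of two neighbouring points, so a limit for the energy
    and a rotation at frozen frequency are enough. The energy is explicit at [x = 0], where parity
    kills one of [He_N] and [He_(N-1)]. Keeping [x0] away from [1] bounds [sin phi] from below, and
    keeping it away from [0] makes [s t] of order [nu] and [s + t] of order [sqrt(nu)]. On the
    quaternionic side the recurrence coefficients are natural numbers, hence central, so
    noncommutativity only enters through [u^k] and [v^k]. They come from the moments of [z^(2m)],
    which are [(-1)^m 3 5 ... (2m+1)]. *)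

Fixpoint hermite n x : R :=
  if n is m.+1 then
    if m is l.+1 then x * hermite m x - m%:R * hermite l x else x
  else 1.

(** For [n = 0] the meaningless [n.-1] is harmless because its coefficient vanishes; the same
    convention is used for [hermite_fun'] and [mopS]. *)
Lemma hermiteS n x : hermite n.+1 x = x * hermite n x - n%:R * hermite n.-1 x.
Proof. by case: n => [|n] //=; rewrite mulr1 mul0r subr0. Qed.

Lemma hermite0 x : hermite 0 x = 1. Proof. by []. Qed.

Lemma hermite1 x : hermite 1 x = x. Proof. by []. Qed.

Arguments hermite : simpl never.

Lemma hermiteN n x : hermite n (- x) = (-1) ^+ n * hermite n x.
Proof.
suff [] : hermite n (- x) = (-1) ^+ n * hermite n x /\
  hermite n.+1 (- x) = (-1) ^+ n.+1 * hermite n.+1 x by [].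
elim: n => [|n [ih1 ih2]]; first by rewrite !(hermite0, hermite1) expr0 expr1; split; ring.
by split=> //; rewrite hermiteS [in RHS]hermiteS ih2 /= ih1 !exprS; ring.
Qed.

Lemma is_derive_hermite n x :
  is_derive x (1 : R) (hermite n) (n%:R * hermite n.-1 x).
Proof.
suff [] : is_derive x (1 : R) (hermite n) (n%:R * hermite n.-1 x) /\
  is_derive x (1 : R) (hermite n.+1) (n.+1%:R * hermite n x) by [].
elim: n => [|n [ih1 ih2]].
  split; first by rewrite mul0r; exact: is_derive_cst.
  by rewrite hermite0 mulr1; exact: is_derive_id.
split=> //.
have -> : hermite n.+2 = id * hermite n.+1 - n.+1%:R *: hermite n :> (R -> R).
  by apply/funext => z; rewrite hermiteS.
apply: is_derive_eq.
rewrite /= /GRing.scale /= [hermite n.+1 x]hermiteS; ring.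
Qed.

Definition hermite_fun n x : R := hermite n x * expR (- (x ^+ 2 / 4)).

Definition hermite_fun' n x : R :=
  - (x / 2) * hermite_fun n x + n%:R * hermite_fun n.-1 x.

Lemma is_derive_hermite_fun n x :
  is_derive x (1 : R) (hermite_fun n) (hermite_fun' n x).
Proof.
have h1 := is_derive_hermite n x.
have h2 : is_derive x (1 : R) (fun z : R => - (z ^+ 2 / 4)) (- (x / 2)).
  apply: is_derive_eq; rewrite /GRing.scale /=; lra.
have h3 := @is_derive1_comp R expR _ x _ _ (is_derive_expR _) h2.
have h4 := is_deriveM h1 h3.
apply: (is_derive_eq h4); rewrite /hermite_fun' /hermite_fun /GRing.scale /=.
ring.
Qed.

(** Weber's equation [w'' = - (n + 1/2 - x^2/4) w], the source of [nu] and of the turning points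
    [x = 2 sqrt(nu)] and [- 2 sqrt(nu)]. *)
Lemma is_derive_hermite_fun' n x :
  is_derive x (1 : R) (hermite_fun' n)
    (- (n%:R + 1 / 2 - x ^+ 2 / 4) * hermite_fun n x).
Proof.
have h1 := is_derive_hermite_fun n x.
have h2 := is_derive_hermite_fun n.-1 x.
have h3 : is_derive x (1 : R) (fun z : R => - (z / 2)) (- (1 / 2)).
  apply: is_derive_eq; rewrite /GRing.scale /=; lra.
have h4 := is_deriveD (is_deriveM h3 h1) (is_deriveZ n%:R h2).
apply: (is_derive_eq h4); rewrite /hermite_fun' /hermite_fun /GRing.scale /=.
case: n {h1 h2 h4} => [|n] /=; first by field.
by rewrite hermiteS; field.
Qed.

End Hermite.

Arguments hermite {R} n x : simpl never.

Section HermiteKernel.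
Context {R : realType}.
Implicit Types (n k : nat) (x s t : R).

Definition hermite_kernel n s t : R :=
  \sum_(k < n.+1) hermite k s * hermite k t / k`!%:R.

Lemma factS_neq0 n : n`!%:R != 0 :> R.
Proof. by rewrite pnatr_eq0 -lt0n fact_gt0. Qed.

Lemma hermite_christoffel_darboux n s t : (s - t) * hermite_kernel n s t =
  (hermite n.+1 s * hermite n t - hermite n s * hermite n.+1 t) / n`!%:R.
Proof.
elim: n => [|n ih].
  by rewrite /hermite_kernel big_ord1 !(hermite0, hermite1) fact0; field.
rewrite /hermite_kernel big_ord_recr mulrDr [X in X + _ = _]ih.
rewrite [hermite n.+2 s]hermiteS [hermite n.+2 t]hermiteS factS natrM /=.
have f0 := factS_neq0 n.
have m0 : n.+1%:R != 0 :> R by rewrite pnatr_eq0.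
by field; rewrite f0 nat1r m0.
Qed.

Lemma hermite_kernel_diag n s : hermite_kernel n s s =
  (n.+1%:R * hermite n s ^+ 2 - n%:R * hermite n.-1 s * hermite n.+1 s) / n`!%:R.
Proof.
elim: n => [|n ih].
  by rewrite /hermite_kernel big_ord1 !(hermite0, hermite1) fact0; field.
rewrite /hermite_kernel big_ord_recr [X in X + _ = _]ih.
rewrite [hermite n.+2 s]hermiteS factS natrM /=.
have f0 := factS_neq0 n.
have m0 : n.+1%:R != 0 :> R by rewrite pnatr_eq0.
rewrite !(@hermiteS _ n) -?natr1.
by field; rewrite f0 natr1.
Qed.

(** Since [He_(n+1) exp(-x^2/4) = (x/2) w - w'] for [w = hermite_fun n], the numerator of
    Christoffel-Darboux is a Wronskian up to a lower order term, and only one degree [n] remains. *)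
Lemma hermite_kernel_wronskian n s t :
  (s - t) * (hermite_kernel n s t * (expR (- (s ^+ 2 / 4)) * expR (- (t ^+ 2 / 4)))) =
  ((s - t) / 2 * (hermite_fun n s * hermite_fun n t) +
   hermite_fun n s * hermite_fun' n t - hermite_fun' n s * hermite_fun n t) / n`!%:R.
Proof.
rewrite mulrA hermite_christoffel_darboux !(@hermiteS _ n).
rewrite /hermite_fun' /hermite_fun.
by have f0 := factS_neq0 n; field.
Qed.

(** The confluent case of [hermite_kernel_wronskian]: [w'^2 - w w''] with [w''] replaced by Weber's
    equation. *)
Lemma hermite_kernel_energy n s :
  hermite_kernel n s s * expR (- (s ^+ 2 / 4)) ^+ 2 =
  (hermite_fun n s ^+ 2 / 2 + hermite_fun' n s ^+ 2 +
   (n%:R + 1 / 2 - s ^+ 2 / 4) * hermite_fun n s ^+ 2) / n`!%:R.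
Proof.
rewrite hermite_kernel_diag !(@hermiteS _ n) /hermite_fun' /hermite_fun.
by rewrite -natr1; have f0 := factS_neq0 n; field.
Qed.

Lemma hermite_kernelN n s t : hermite_kernel n s (- t) =
  \sum_(k < n.+1) (-1) ^+ k * (hermite k s * hermite k t / k`!%:R).
Proof. by apply: eq_bigr => k _; rewrite hermiteN; ring. Qed.

End HermiteKernel.

(** * Rapidly oscillating systems *)

Section Monotone.
Context {R : realType}.

Lemma ge0_is_derive_le (f df : R -> R) (a b : R) : a <= b ->
  (forall x, a <= x <= b -> is_derive x (1 : R) f (df x)) ->
  (forall x, a <= x <= b -> 0 <= df x) -> f a <= f b.
Proof.
move=> ab fdf df0.
have cf : {within `[a, b], continuous f}.
  apply: derivable_within_continuous => x; rewrite in_itv /= => xab.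
  by have [] := fdf x xab.
have fdf' x : x \in `]a, b[ -> is_derive x (1 : R) f (df x).
  by move=> /itvP xab; apply: fdf; rewrite !xab.
have [c /itvP cab fE] := MVT_segment ab fdf' cf.
by rewrite -subr_ge0 fE mulr_ge0 ?subr_ge0// df0 ?cab.
Qed.

End Monotone.

Section AdiabaticInvariant.
Context {R : realType}.

(** The [4] bounds [1 + 3 cos^2] in the derivative of the corrected energy where [sin >= k]. *)
Definition adiabatic_rate (k L : R) : R := 4 / (k ^+ 4 * L).

Variables (L : R) (y p : R -> R).
Hypothesis dy : forall t, is_derive t (1 : R) y (- L * sin t * p t).
Hypothesis dp : forall t, is_derive t (1 : R) p (L * sin t ^+ 3 * y t).

(** Twice the action [H / omega] of the oscillator with [H = (L sin t p^2 + L sin^3 t y^2) / 2] and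
    frequency [omega = L sin^2 t]; the action is the adiabatic invariant. *)
Definition osc_energy t : R := p t ^+ 2 / sin t + sin t * y t ^+ 2.

Lemma osc_energy_ge0 t : 0 <= sin t -> 0 <= osc_energy t.
Proof.
by move=> s0; apply: addr_ge0; rewrite mulr_ge0 ?sqr_ge0 ?invr_ge0.
Qed.

(* The derivative [cos t (y^2 - p^2 / sin^2 t)] of the energy is not small but oscillates; the last
   term, of order [1/L], cancels it up to order [1/L]. *)
Let J t : R := p t ^+ 2 / sin t + sin t * y t ^+ 2
  - cos t / (L * sin t ^+ 3) * (y t * p t).
Let J' t : R := ((sin t)^-1 ^+ 2 + 3 * cos t ^+ 2 * (sin t)^-1 ^+ 4) / L * (y t * p t).

Let dJ t : L != 0 -> sin t != 0 -> is_derive t (1 : R) J (J' t).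
Proof.
move=> L0 s0.
have hi : is_derive t (1 : R) (fun t => (sin t)^-1) (- (sin t) ^- 2 * cos t).
  exact: (@is_deriveV _ sin t _ _ s0 (is_derive_sin t)).
have -> : J = (p * p) * (fun t => (sin t)^-1) + sin * (y * y)
  - (cos * ((fun t => (sin t)^-1) ^+ 3)) * (cst L^-1 * (y * p)) :> (R -> R).
  apply/funext => z; rewrite /J /= /GRing.scale /= !fctE.
  by rewrite invfM -exprVn; ring.
have hdy := dy t; have hdp := dp t.
apply: is_derive_eq; rewrite /J' /GRing.scale /= !fctE.
by field; rewrite L0 s0.
Qed.

Let norm_yp_le t : 0 < sin t -> `|y t * p t| <= osc_energy t / 2.
Proof.
move=> s0; have i0 : 0 < (sin t)^-1 by rewrite invr_gt0.
have e1 : 0 <= (p t - sin t * y t) ^+ 2 / sin t by rewrite mulr_ge0 ?sqr_ge0 ?ltW.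
have e2 : 0 <= (p t + sin t * y t) ^+ 2 / sin t by rewrite mulr_ge0 ?sqr_ge0 ?ltW.
have h1 : (p t - sin t * y t) ^+ 2 / sin t = osc_energy t - 2 * (y t * p t).
  by rewrite /osc_energy; field; rewrite gt_eqF.
have h2 : (p t + sin t * y t) ^+ 2 / sin t = osc_energy t + 2 * (y t * p t).
  by rewrite /osc_energy; field; rewrite gt_eqF.
rewrite ler_norml; move: e1 e2; rewrite h1 h2; lra.
Qed.

Variables k M : R.
Hypotheses (L0 : 0 < L) (k0 : 0 < k) (ME : M = adiabatic_rate k L).

Let M_ge0 : 0 <= M.
Proof. by rewrite ME /adiabatic_rate divr_ge0 ?mulr_ge0 ?exprn_ge0 ?ltW. Qed.

Let invsin_le t : k <= sin t -> (sin t)^-1 ^+ 4 <= k^-1 ^+ 4.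
Proof.
move=> ks; have s0 : 0 < sin t by exact: lt_le_trans ks.
apply: lerXn2r; rewrite ?nnegrE ?invr_ge0 ?(ltW s0) ?(ltW k0)//.
by rewrite lef_pV2.
Qed.

Let invsin_ge1 t : k <= sin t -> 1 <= (sin t)^-1.
Proof.
move=> ks; have s0 : 0 < sin t by exact: lt_le_trans ks.
by rewrite invf_ge1// sin_le1.
Qed.

Let norm_JB t : k <= sin t -> `|J t - osc_energy t| <= M / 8 * osc_energy t.
Proof.
move=> ks; have s0 : 0 < sin t by exact: lt_le_trans ks.
have -> : J t - osc_energy t = - (cos t * ((sin t)^-1 ^+ 3 / L) * (y t * p t)).
  by rewrite /J /osc_energy; field; rewrite !gt_eqF.
rewrite normrN normrM.
have -> : M / 8 * osc_energy t = k^-1 ^+ 4 / L * (osc_energy t / 2).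
  by rewrite ME /adiabatic_rate; field; rewrite !gt_eqF.
apply: ler_pM => //; last exact: norm_yp_le.
have i0 : 0 < (sin t)^-1 by rewrite invr_gt0.
rewrite normrM [`|_ / L|]ger0_norm; last first.
  by rewrite divr_ge0 ?exprn_ge0 ?ltW.
rewrite -[leRHS]mul1r; apply: ler_pM => //.
- by rewrite divr_ge0 ?exprn_ge0 ?ltW.
- by rewrite ler_norml cos_geN1 cos_le1.
rewrite ler_pM2r ?invr_gt0//.
apply: (@le_trans _ _ ((sin t)^-1 ^+ 4)); last exact: invsin_le.
by rewrite [leRHS]exprS ler_peMl ?exprn_ge0 ?(ltW i0) ?invsin_ge1.
Qed.

Let norm_J' t : k <= sin t -> `|J' t| <= M / 2 * osc_energy t.
Proof.
move=> ks; have s0 : 0 < sin t by exact: lt_le_trans ks.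
have i0 : 0 < (sin t)^-1 by rewrite invr_gt0.
rewrite /J' normrM.
have -> : M / 2 * osc_energy t = 4 * k^-1 ^+ 4 / L * (osc_energy t / 2).
  by rewrite ME /adiabatic_rate; field; rewrite !gt_eqF.
apply: ler_pM => //; last exact: norm_yp_le.
rewrite ger0_norm; last first.
  apply: divr_ge0; last exact: ltW.
  apply: addr_ge0; first exact: sqr_ge0.
  by apply: mulr_ge0; [apply: mulr_ge0 => //; exact: sqr_ge0|rewrite exprn_ge0// ltW].
rewrite ler_pM2r ?invr_gt0//.
have h := invsin_le ks; have h1 := invsin_ge1 ks.
have h2 : (sin t)^-1 ^+ 2 <= (sin t)^-1 ^+ 4
  by rewrite [leRHS](exprD _ 2 2) ler_peMl ?sqr_ge0 ?exprn_ege1.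
have h3 : cos t ^+ 2 * (sin t)^-1 ^+ 4 <= (sin t)^-1 ^+ 4.
  rewrite -[leRHS]mul1r ler_wpM2r ?exprn_ge0 ?(ltW i0)// cos2_le1.
lra.
Qed.

Hypothesis M1 : M <= 1.

(** As [M <= 1], [norm_JB] gives [J >= 7/8] of the energy, which absorbs the factor [1/2] of
    [norm_J'] and yields a differential inequality in [J] alone. *)
Let norm_J'_J t : k <= sin t -> `|J' t| <= M * J t.
Proof.
move=> ks; have s0 : 0 < sin t by exact: lt_le_trans ks.
have e0 : 0 <= osc_energy t.
  exact/osc_energy_ge0/ltW.
apply: le_trans (norm_J' ks) _; rewrite -mulrA ler_wpM2l//.
have := norm_JB ks; rewrite ler_norml => /andP[h _].
have : M / 8 * osc_energy t <= 1 / 8 * osc_energy t.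
  by apply: ler_wpM2r => //; move: M1; lra.
lra.
Qed.

(** Gronwall in both directions: [|J'| <= M J] makes [J exp(M t)] increase and [J exp(-M t)]
    decrease. *)
Let J_growth a b : a <= b -> (forall t, a <= t <= b -> k <= sin t) ->
  J a * expR (M * a) <= J b * expR (M * b) /\
  J b * expR (- M * b) <= J a * expR (- M * a).
Proof.
move=> ab ks.
have dE (c t : R) : is_derive t (1 : R) (fun x => expR (c * x)) (c * expR (c * t)).
  have h : is_derive t (1 : R) (fun x : R => c * x) c.
    apply: (is_derive_eq (is_deriveM (is_derive_cst c t 1) (is_derive_id t 1))).
    by rewrite /GRing.scale /= mulr1 mulr0 addr0.
  apply: (is_derive_eq (@is_derive1_comp R expR _ t _ _ (is_derive_expR _) h)).
  exact: mulrC.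
have dJe (c t : R) : a <= t <= b -> is_derive t (1 : R) (fun x => J x * expR (c * x))
    ((J' t + c * J t) * expR (c * t)).
  move=> tab; have s0 : 0 < sin t by apply: lt_le_trans (ks _ tab).
  have h1 := dJ (lt0r_neq0 L0) (lt0r_neq0 s0).
  apply: (is_derive_eq (is_deriveM h1 (dE c t))).
  by rewrite /GRing.scale /=; ring.
split.
  apply: (ge0_is_derive_le ab (dJe M)) => t tab.
  rewrite mulr_ge0 ?expR_ge0//.
  have := norm_J'_J (ks _ tab); rewrite ler_norml => /andP[+ _]; lra.
rewrite -lerN2.
apply: (@ge0_is_derive_le _ (fun x => - (J x * expR (- M * x)))
  (fun x => - ((J' x + - M * J x) * expR (- M * x))) _ _ ab) => t tab.
  by apply: is_deriveN; exact: dJe.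
rewrite -mulNr mulr_ge0 ?expR_ge0//.
have := norm_J'_J (ks _ tab); rewrite ler_norml => /andP[_]; lra.
Qed.

(** The comparison point is [pi / 2] because [cos] vanishes there, so that [J] equals the energy
    exactly. *)
Lemma osc_energy_adiabatic t : 0 <= t <= pi / 2 -> k <= sin t ->
  osc_energy (pi / 2) * expR (- (2 * M)) <= osc_energy t * (1 + M) /\
  osc_energy t * (1 - M) <= osc_energy (pi / 2) * expR (2 * M).
Proof.
move=> /andP[t0 tpi] ks.
have s0 : 0 < sin t by exact: lt_le_trans ks.
have e0 : 0 <= osc_energy t.
  exact/osc_energy_ge0/ltW.
have ks' x : t <= x <= pi / 2 -> k <= sin x.
  move=> /andP[tx xpi]; apply: le_trans ks _.
  rewrite leNgt ltr_sin -?leNgt// in_itv /=; apply/andP; split => //; have := @pi_ge0 R; lra.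
have [h1 h2] := J_growth tpi ks'.
have JpiE : J (pi / 2) = osc_energy (pi / 2).
  by rewrite /J /osc_energy cos_pihalf mul0r mul0r subr0.
have := norm_JB ks; rewrite ler_norml => /andP[h3 h4].
have h5 : M / 8 * osc_energy t <= M * osc_energy t.
  by apply: ler_wpM2r => //; move: M_ge0; lra.
(* From [pi / 2 < 2]: this bound on the exponent does not depend on [t]. *)
have pi2 : M * (pi / 2 - t) <= 2 * M.
  rewrite mulrC ler_wpM2r//; have := @pihalf_lt2 R; lra.
have epi0 : 0 <= osc_energy (pi / 2).
  by rewrite /osc_energy sin_pihalf divr1 mul1r addr_ge0 ?sqr_ge0.
split.
  have : osc_energy (pi / 2) * expR (- (M * (pi / 2 - t))) <= J t.
    have := ler_wpM2r (expR_ge0 (M * t)) h2; rewrite -!mulrA -!expRD JpiE.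
    have -> : - M * t + M * t = 0 by ring.
    have -> : - M * (pi / 2) + M * t = - (M * (pi / 2 - t)) by ring.
    by rewrite expR0 mulr1.
  move=> h6; have : osc_energy (pi / 2) * expR (- (2 * M)) <= J t.
    apply: le_trans _ h6; by rewrite ler_wpM2l// ler_expR lerN2.
  lra.
have : J t <= osc_energy (pi / 2) * expR (M * (pi / 2 - t)).
  have := ler_wpM2r (expR_ge0 (- (M * t))) h1; rewrite -!mulrA -!expRD JpiE.
  have -> : M * (pi / 2) + - (M * t) = M * (pi / 2 - t) by ring.
  by rewrite addrN expR0 mulr1.
move=> h6; have : J t <= osc_energy (pi / 2) * expR (2 * M).
  by apply: le_trans h6 _; rewrite ler_wpM2l// ler_expR.
lra.
Qed.

End AdiabaticInvariant.

(** * Limits of real sequences and the mean value inequality *)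

Section RealSequences.
Context {R : realType}.
Implicit Types (u v : nat -> R).

Lemma cvg_near_eq u v (l : R) : u n @[n --> \oo] --> l ->
  (\forall n \near \oo, u n = v n) -> v n @[n --> \oo] --> l.
Proof.
move=> ul uv; apply: cvg_trans ul; apply: near_eq_cvg.
by apply: filterS uv => n ->.
Qed.

Lemma cvg0_norm_le u v : (\forall n \near \oo, `|u n| <= v n) ->
  v n @[n --> \oo] --> 0 -> u n @[n --> \oo] --> 0.
Proof.
move=> uv v0; apply: norm_cvg0.
apply: (squeeze_cvgr (f := fun=> 0) (h := v)) => //; last exact: cvg_cst.
by apply: filterS uv => n; rewrite normr_ge0.
Qed.

Lemma cvg0_bounded_mul u v (B : R) : (\forall n \near \oo, `|u n| <= B) ->
  v n @[n --> \oo] --> 0 -> u n * v n @[n --> \oo] --> 0.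
Proof.
move=> uB v0; apply: (@cvg0_norm_le _ (fun n => B * `|v n|)).
  by apply: filterS uB => n uB; rewrite normrM ler_wpM2r.
rewrite -(mulr0 B); apply: cvgMl_tmp; rewrite -(@normr0 _ R); exact: cvg_norm.
Qed.

(** Stated with absolute values because the shifts to which it is applied have either sign. *)
Lemma is_derive_norm_le (f df : R -> R) (C a b : R) :
  (forall x, `|x - a| <= `|b - a| -> is_derive x (1 : R) f (df x)) ->
  (forall x, `|x - a| <= `|b - a| -> `|df x| <= C) ->
  `|f b - f a| <= C * `|b - a|.
Proof.
move=> fdf dfC.
have cf c d : (forall x, c <= x <= d -> `|x - a| <= `|b - a|) ->
    {within `[c, d], continuous f}.
  move=> cd; apply: derivable_within_continuous => x; rewrite in_itv /= => xab.
  by have [] := fdf x (cd _ xab).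
have [ab|ba] := leP a b.
  have h x : a <= x <= b -> `|x - a| <= `|b - a|.
    by move=> xab; rewrite !ger0_norm; lra.
  have fdf' x : x \in `]a, b[ -> is_derive x (1 : R) f (df x).
    by move=> /itvP xab; apply/fdf/h; rewrite !xab.
  have [c /itvP cab fE] := MVT_segment ab fdf' (cf _ _ h).
  by rewrite fE normrM ler_wpM2r// dfC// h// !cab.
have h x : b <= x <= a -> `|x - a| <= `|b - a|.
  by move=> xab; rewrite !ler0_norm; lra.
have fdf' x : x \in `]b, a[ -> is_derive x (1 : R) f (df x).
  by move=> /itvP xab; apply/fdf/h; rewrite !xab.
have [c /itvP cab fE] := MVT_segment (ltW ba) fdf' (cf _ _ h).
by rewrite distrC fE normrM [`|a - b|]distrC ler_wpM2r// dfC// h// !cab.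
Qed.

Lemma norm_sinB_le (x z : R) : `|sin x - sin z| <= `|x - z|.
Proof.
rewrite -[leRHS]mul1r; apply: (@is_derive_norm_le sin cos) => w _.
  exact: cos_max.
Qed.

End RealSequences.

(** * High frequency limit: energy, rotating frame and Wronskian *)

Section Oscillation.
Context {R : realType}.
Variables (L : nat -> R) (y p : nat -> R -> R).
Hypothesis dy : forall n t, is_derive t (1 : R) (y n) (- L n * sin t * p n t).
Hypothesis dp : forall n t, is_derive t (1 : R) (p n) (L n * sin t ^+ 3 * y n t).
Hypothesis Ly : L n @[n --> \oo] --> +oo.
Variable e : R.
Hypothesis Ee : osc_energy (y n) (p n) (pi / 2) @[n --> \oo] --> e.
Variable phi : R.
Hypothesis phi_itv : 0 < phi < pi / 2.

Let k : R := sin (phi / 2).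

Let k0 : 0 < k.
Proof. by apply: sin_gt0_pihalf; have := phi_itv; lra. Qed.

Let sin_ge t : phi / 2 <= t <= pi / 2 -> k <= sin t.
Proof.
move=> h; rewrite /k leNgt ltr_sin -?leNgt; first by case/andP: h.
- by rewrite in_itv /=; have := phi_itv; lra.
- by rewrite in_itv /=; have := phi_itv; lra.
Qed.

Let rate n := adiabatic_rate k (L n).

Let rate0 : rate n @[n --> \oo] --> 0.
Proof.
rewrite (_ : rate = fun n => (4 / k ^+ 4) * (L n)^-1); last first.
  by apply/funext => n; rewrite /rate /adiabatic_rate invfM mulrA.
rewrite -(mulr0 (4 / k ^+ 4)); apply: cvgMl_tmp.
have h : \forall n \near \oo, 0 < L n by move/cvgryPgt : Ly; apply.
exact: ((gtr0_cvgV0 h).2 Ly).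
Qed.

(** The rank is chosen before [t]. This uniformity permits evaluation at points that move with
    [n]. *)
Let adiabatic_near : \forall n \near \oo, rate n <= 1 / 2 /\
  forall t, phi / 2 <= t <= pi / 2 ->
  osc_energy (y n) (p n) (pi / 2) * expR (- (2 * rate n)) / (1 + rate n) <=
    osc_energy (y n) (p n) t /\
  osc_energy (y n) (p n) t <=
    osc_energy (y n) (p n) (pi / 2) * expR (2 * rate n) / (1 - rate n).
Proof.
near=> n.
have L0 : 0 < L n by near: n; move/cvgryPgt : Ly; apply.
have r0 : 0 <= rate n.
  by rewrite /rate /adiabatic_rate divr_ge0// mulr_ge0 ?exprn_ge0 ?ltW.
have r12 : rate n <= 1 / 2.
  near: n; have /cvgr_le := rate0; apply; lra.
split=> // t tphi.
have t02 : 0 <= t <= pi / 2 by have := phi_itv; lra.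
have r1 : rate n <= 1 by lra.
have [h1 h2] := osc_energy_adiabatic (dy n) (dp n) L0 k0 (erefl _) r1 t02 (sin_ge tphi).
by rewrite ler_pdivrMr ?ler_pdivlMr//; lra.
Unshelve. all: by end_near. Qed.

Lemma osc_energy_cvg (th : nat -> R) : th n @[n --> \oo] --> phi ->
  osc_energy (y n) (p n) (th n) @[n --> \oo] --> e.
Proof.
move=> thphi.
apply: (squeeze_cvgr
  (f := fun n => osc_energy (y n) (p n) (pi / 2) * expR (- (2 * rate n)) / (1 + rate n))
  (h := fun n => osc_energy (y n) (p n) (pi / 2) * expR (2 * rate n) / (1 - rate n))).
- near=> n; apply/andP.
  suff : phi / 2 <= th n <= pi / 2.
    by move: (th n); near: n; apply: filterS adiabatic_near => n [].
  apply/andP; split; near: n.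
    by have /cvgr_ge := thphi; apply; have := phi_itv; lra.
  by have /cvgr_le := thphi; apply; have := phi_itv; lra.
- have <- : e * expR (- (2 * 0)) / (1 + 0) = e.
    by rewrite mulr0 oppr0 expR0 addr0 invr1 !mulr1.
  apply: cvgM; last first.
    by apply: cvgV; [rewrite addr0 oner_neq0|apply: cvgD => //; exact: cvg_cst].
  apply: cvgM => //; apply: continuous_cvg; first exact: continuous_expR.
  by apply: cvgN; exact: cvgMl_tmp.
- have <- : e * expR (2 * 0) / (1 - 0) = e.
    by rewrite mulr0 expR0 subr0 invr1 !mulr1.
  apply: cvgM; last first.
    by apply: cvgV; [rewrite subr0 oner_neq0|apply: cvgB => //; exact: cvg_cst].
  apply: cvgM => //; apply: continuous_cvg; first exact: continuous_expR.
  exact: cvgMl_tmp.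
Unshelve. all: by end_near. Qed.

Lemma osc_bounded : exists B, 0 < B /\ \forall n \near \oo,
  forall t, phi / 2 <= t <= pi / 2 -> `|y n t| <= B /\ `|p n t| <= B.
Proof.
(* For large [n] the energy at [pi / 2] is at most [e + 1], and [rate n <= 1/2] bounds the
   exponential by [expR 1] and the inverse of [1 - rate n] by [2]. The later division by [k]
   accounts for the weight [sin t >= k] of [y^2]. *)
pose E0 := (e + 1) * expR 1 * 2.
have e0 : 0 <= e.
  apply: (cvgr_to_ge Ee); near=> n.
  by apply: osc_energy_ge0; rewrite sin_pihalf.
have E00 : 0 < E0 by rewrite !mulr_gt0 ?expR_gt0//; lra.
have Ek : E0 <= E0 / k.
  by rewrite ler_peMr ?(ltW E00)// invf_ge1// sin_le1.
exists (Num.sqrt (E0 / k)); split; first by rewrite sqrtr_gt0 divr_gt0.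
have E1 : \forall n \near \oo, osc_energy (y n) (p n) (pi / 2) <= e + 1.
  by have /cvgr_le := Ee; apply; lra.
near=> n => t tphi.
have [r12 /(_ t tphi) [_ h]] : rate n <= 1 / 2 /\ forall t, phi / 2 <= t <= pi / 2 ->
  osc_energy (y n) (p n) (pi / 2) * expR (- (2 * rate n)) / (1 + rate n) <=
    osc_energy (y n) (p n) t /\
  osc_energy (y n) (p n) t <=
    osc_energy (y n) (p n) (pi / 2) * expR (2 * rate n) / (1 - rate n) by near: n.
have s0 : 0 < sin t by apply: lt_le_trans k0 (sin_ge tphi).
have hE : osc_energy (y n) (p n) t <= E0.
  apply: le_trans h _; rewrite /E0; apply: ler_pM.
  - rewrite mulr_ge0 ?expR_ge0//; apply: osc_energy_ge0; rewrite sin_pihalf //.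
  - by rewrite invr_ge0; lra.
  - apply: ler_pM; rewrite ?expR_ge0//.
    + by apply: osc_energy_ge0; rewrite sin_pihalf.
    + by near: n.
    + by rewrite ler_expR; lra.
  - by rewrite invf_ple ?posrE//; lra.
have p0 : 0 <= p n t ^+ 2 / sin t by rewrite mulr_ge0 ?sqr_ge0 ?invr_ge0 ?ltW.
have y0 : 0 <= sin t * y n t ^+ 2 by rewrite mulr_ge0 ?sqr_ge0 ?ltW.
split; rewrite -sqrtr_sqr ler_sqrt ?divr_ge0 ?(ltW E00) ?(ltW k0)//.
  rewrite ler_pdivlMr//; apply: le_trans hE.
  apply: (@le_trans _ _ (sin t * y n t ^+ 2)); last by rewrite lerDr.
  by rewrite mulrC ler_wpM2r ?sqr_ge0 ?sin_ge.
apply: le_trans Ek; apply: le_trans hE.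
apply: (@le_trans _ _ (p n t ^+ 2 / sin t)); last by rewrite lerDl.
by rewrite ler_peMr ?sqr_ge0// invf_ge1// sin_le1.
Unshelve. all: by end_near. Qed.

Let kappa : R := sin phi.

Let kappa0 : 0 < kappa.
Proof. by apply: sin_gt0_pihalf; have := phi_itv; lra. Qed.

Let near_small (x : R) : `|x| <= phi / 2 -> `|x| <= pi / 2 - phi ->
  phi / 2 <= phi + x <= pi / 2.
Proof. by rewrite !ler_norml; lra. Qed.

(* The solution in the frame rotating with the frozen frequency [L n * kappa ^+ 2]. *)
Let rotA n x : R := kappa * y n (phi + x) * cos (L n * kappa ^+ 2 * x)
  + p n (phi + x) * sin (L n * kappa ^+ 2 * x).
Let rotB n x : R := - (kappa * y n (phi + x) * sin (L n * kappa ^+ 2 * x))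
  + p n (phi + x) * cos (L n * kappa ^+ 2 * x).

(** What is left of the derivative once the rotation at frozen coefficients has cancelled: every
    term carries a difference between [sin (phi + x)] and [kappa]. *)
Let drift n c1 c2 x : R :=
  c1 * (L n * (kappa * (kappa - sin (phi + x)) * p n (phi + x))) +
  c2 * (L n * ((sin (phi + x) ^+ 3 - kappa ^+ 3) * y n (phi + x))).

Let is_derive_rot n x :
  is_derive x (1 : R) (rotA n) (drift n (cos (L n * kappa ^+ 2 * x)) (sin (L n * kappa ^+ 2 * x)) x) /\
  is_derive x (1 : R) (rotB n) (drift n (- sin (L n * kappa ^+ 2 * x)) (cos (L n * kappa ^+ 2 * x)) x).
Proof.
have ht : is_derive x (1 : R) (fun x : R => phi + x) 1.
  apply: (is_derive_eq (is_deriveD (is_derive_cst phi x 1) (is_derive_id x 1))).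
  by rewrite add0r.
have hb : is_derive x (1 : R) (fun x : R => L n * kappa ^+ 2 * x) (L n * kappa ^+ 2).
  apply: (is_derive_eq (is_deriveM (is_derive_cst (L n * kappa ^+ 2) x 1) (is_derive_id x 1))).
  by rewrite /GRing.scale /= mulr1 mulr0 addr0.
have hy := @is_derive1_comp R (y n) _ x _ _ (dy n _) ht.
have hp := @is_derive1_comp R (p n) _ x _ _ (dp n _) ht.
have hc := @is_derive1_comp R cos _ x _ _ (is_derive_cos _) hb.
have hs := @is_derive1_comp R sin _ x _ _ (is_derive_sin _) hb.
split.
  apply: (is_derive_eq (is_deriveD (is_deriveM (is_deriveM (is_derive_cst kappa x 1) hy) hc)
    (is_deriveM hp hs))).
  by rewrite /drift /GRing.scale /= !fctE /=; ring.
apply: (is_derive_eq (is_deriveD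
  (is_deriveN (is_deriveM (is_deriveM (is_derive_cst kappa x 1) hy) hs)) (is_deriveM hp hc))).
by rewrite /drift /GRing.scale /= !fctE /=; ring.
Qed.

Let norm_drift n c1 c2 x (B : R) : 0 < L n -> `|c1| <= 1 -> `|c2| <= 1 ->
  `|y n (phi + x)| <= B -> `|p n (phi + x)| <= B ->
  `|drift n c1 c2 x| <= 4 * B * L n * `|x|.
Proof.
move=> L0 c11 c21 yB pB.
have B0 : 0 <= B by exact: le_trans yB.
have hs : `|sin (phi + x) - kappa| <= `|x|.
  by apply: le_trans (norm_sinB_le _ _) _; rewrite addrAC subrr add0r.
have k1 : `|kappa| <= 1 by exact: sin_max.
have s1 : `|sin (phi + x)| <= 1 by exact: sin_max.
have hs3 : `|sin (phi + x) ^+ 3 - kappa ^+ 3| <= 3 * `|x|.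
  have -> : sin (phi + x) ^+ 3 - kappa ^+ 3 = (sin (phi + x) ^+ 2 +
    sin (phi + x) * kappa + kappa ^+ 2) * (sin (phi + x) - kappa) by ring.
  rewrite normrM ler_pM//.
  apply: le_trans (ler_normD _ _) _.
  have := ler_normD (sin (phi + x) ^+ 2) (sin (phi + x) * kappa).
  have : `|sin (phi + x) ^+ 2| <= 1 by rewrite normrX expr_le1.
  have : `|kappa ^+ 2| <= 1 by rewrite normrX expr_le1.
  have : `|sin (phi + x) * kappa| <= 1 by rewrite normrM mulr_ile1.
  lra.
apply: le_trans (ler_normD _ _) _.
have h1 : `|c1 * (L n * (kappa * (kappa - sin (phi + x)) * p n (phi + x)))| <= L n * (`|x| * B).
  rewrite !normrM (gtr0_norm L0) -[leRHS]mul1r; apply: ler_pM => //.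
    by rewrite !mulr_ge0// ltW.
  apply: ler_wpM2l; first exact: ltW.
  apply: ler_pM; rewrite ?mulr_ge0//.
  by rewrite -[leRHS]mul1r ler_pM// distrC.
have h2 : `|c2 * (L n * ((sin (phi + x) ^+ 3 - kappa ^+ 3) * y n (phi + x)))| <= L n * (3 * `|x| * B).
  rewrite !normrM (gtr0_norm L0) -[leRHS]mul1r; apply: ler_pM => //.
    by rewrite !mulr_ge0// ltW.
  by apply: ler_wpM2l; [exact: ltW|apply: ler_pM; rewrite ?mulr_ge0].
lra.
Qed.

Let invL0 : (L n)^-1 @[n --> \oo] --> 0.
Proof.
have h : \forall n \near \oo, 0 < L n by move/cvgryPgt : Ly; apply.
exact: ((gtr0_cvgV0 h).2 Ly).
Qed.

Lemma shift_cvg0 (al : nat -> R) (a : R) : L n * al n @[n --> \oo] --> a ->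
  al n @[n --> \oo] --> 0.
Proof.
move=> ha; rewrite -(mul0r a).
have h : \forall n \near \oo, 0 < L n by move/cvgryPgt : Ly; apply.
apply: cvg_trans (cvgM invL0 ha); apply: near_eq_cvg.
by apply: filterS h => n Ln0 /=; rewrite mulKf// gt_eqF.
Qed.

(** The drift is [O(L |x|)] by [norm_drift]. Over an interval of length [|al n|], which is [O(1/L)],
    it accumulates to [O(L |al n|^2)], hence tends to [0]. *)
Let rot_cvg (al : nat -> R) (a : R) : L n * al n @[n --> \oo] --> a ->
  rotA n (al n) - kappa * y n phi @[n --> \oo] --> 0 /\
  rotB n (al n) - p n phi @[n --> \oo] --> 0.
Proof.
move=> ha; have al0 := shift_cvg0 ha.
have [B [B0 hB]] := osc_bounded.
have h : \forall n \near \oo, 0 < L n by move/cvgryPgt : Ly; apply.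
have hal : \forall n \near \oo, `|al n| <= phi / 2 /\ `|al n| <= pi / 2 - phi.
  have [p1 p2] : 0 < phi / 2 /\ 0 < pi / 2 - phi by have := phi_itv; lra.
  near=> n; split; near: n.
    by have /cvgr0_norm_le := al0; apply.
  by have /cvgr0_norm_le := al0; apply.
have lim0 : 4 * B * (`|L n * al n| * `|al n|) @[n --> \oo] --> 0.
  rewrite -[X in _ --> X](mulr0 (4 * B)); apply: cvgMl_tmp.
  rewrite -(mulr0 `|a|); apply: cvgM; first exact: cvg_norm.
  by rewrite -(@normr0 _ R); exact: cvg_norm.
have bound n (f df : R -> R) : 0 < L n ->
    (forall x, `|x| <= `|al n| -> is_derive x (1 : R) f (df x)) ->
    (forall x, `|x| <= `|al n| -> `|df x| <= 4 * B * L n * `|al n|) ->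
    `|f (al n) - f 0| <= 4 * B * (`|L n * al n| * `|al n|).
  move=> Ln0 fdf dfB.
  have := @is_derive_norm_le _ f df (4 * B * L n * `|al n|) 0 (al n).
  rewrite subr0 normrM (gtr0_norm Ln0) => /(_ _ _)/le_trans; apply.
  - by move=> x; rewrite subr0; exact: fdf.
  - by move=> x; rewrite subr0; exact: dfB.
  - by rewrite -!mulrA.
have yp n x : `|al n| <= phi / 2 /\ `|al n| <= pi / 2 - phi -> `|x| <= `|al n| ->
    phi / 2 <= phi + x <= pi / 2.
  by move=> [h1 h2] xa; apply: near_small; apply: le_trans xa _.
split; apply: cvg0_norm_le lim0; near=> n.
- have -> : kappa * y n phi = rotA n 0 by rewrite /rotA mulr0 cos0 sin0 addr0 mulr0 addr0 mulr1.
  have Ln0 : 0 < L n by near: n.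
  have hn : `|al n| <= phi / 2 /\ `|al n| <= pi / 2 - phi by near: n.
  apply: (bound n _ _ Ln0 (fun x _ => (is_derive_rot n x).1)) => x xal.
  have [h1 h2] : `|y n (phi + x)| <= B /\ `|p n (phi + x)| <= B.
    by have := yp _ _ hn xal; move: (phi + x); near: n.
  apply: le_trans (norm_drift Ln0 (cos_max _) (sin_max _) h1 h2) _.
  by rewrite ler_wpM2l// !mulr_ge0// ltW.
- have -> : p n phi = rotB n 0 by rewrite /rotB mulr0 cos0 sin0 addr0 mulr0 oppr0 add0r mulr1.
  have Ln0 : 0 < L n by near: n.
  have hn : `|al n| <= phi / 2 /\ `|al n| <= pi / 2 - phi by near: n.
  apply: (bound n _ _ Ln0 (fun x _ => (is_derive_rot n x).2)) => x xal.
  have [h1 h2] : `|y n (phi + x)| <= B /\ `|p n (phi + x)| <= B.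
    by have := yp _ _ hn xal; move: (phi + x); near: n.
  apply: le_trans (norm_drift Ln0 _ (cos_max _) h1 h2) _.
    by rewrite normrN sin_max.
  by rewrite ler_wpM2l// !mulr_ge0// ltW.
Unshelve. all: by end_near. Qed.

Lemma osc_wronskian_cvg (al be : nat -> R) (a b : R) :
  L n * al n @[n --> \oo] --> a -> L n * be n @[n --> \oo] --> b ->
  y n (phi + al n) * p n (phi + be n) - p n (phi + al n) * y n (phi + be n)
    @[n --> \oo] --> e * sin (kappa ^+ 2 * (b - a)).
Proof.
move=> ha hb.
have [uA uB] := rot_cvg ha; have [vA vB] := rot_cvg hb.
have [B [B0 hB]] := osc_bounded.
(* [A0] and [B0'] are only known to be bounded, since the phase at [phi] is not controlled. [S1] and
   [S2] below, the scalar and the cross product of the two rotated states, are therefore expanded so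
   that of [A0] and [B0'] alone only [A0^2 + B0'^2], which is [kappa] times the energy, remains; it
   converges. *)
pose A0 n := kappa * y n phi; pose B0' n := p n phi.
pose uA' n := rotA n (al n) - A0 n; pose uB' n := rotB n (al n) - B0' n.
pose vA' n := rotA n (be n) - A0 n; pose vB' n := rotB n (be n) - B0' n.
have hphi : phi / 2 <= phi <= pi / 2 by have := phi_itv; lra.
have bA : \forall n \near \oo, `|A0 n| <= B.
  apply: filterS hB => n /(_ _ hphi)[yB _]; rewrite /A0 normrM.
  by rewrite -[leRHS]mul1r ler_pM// sin_max.
have bB : \forall n \near \oo, `|B0' n| <= B.
  by apply: filterS hB => n /(_ _ hphi)[].
pose D n := L n * kappa ^+ 2 * be n - L n * kappa ^+ 2 * al n.
have hD : D n @[n --> \oo] --> kappa ^+ 2 * (b - a).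
  rewrite (_ : D = fun n => kappa ^+ 2 * (L n * be n - L n * al n)); last first.
    by apply/funext => n; rewrite /D; ring.
  by apply: cvgMl_tmp; exact: cvgB.
have hE : osc_energy (y n) (p n) phi @[n --> \oo] --> e.
  exact: osc_energy_cvg (cvg_cst _).
pose S1 n := kappa * osc_energy (y n) (p n) phi + (A0 n * (uA' n + vA' n) +
  B0' n * (uB' n + vB' n) + uA' n * vA' n + uB' n * vB' n).
pose S2 n := A0 n * (vB' n - uB' n) + B0' n * (uA' n - vA' n)
  + uA' n * vB' n - uB' n * vA' n.
have hS1 : S1 n @[n --> \oo] --> kappa * e + (0 + 0 + 0 * 0 + 0 * 0).
  apply: cvgD; first exact: cvgMl_tmp.
  apply: cvgD; last exact: cvgM.
  apply: cvgD; last exact: cvgM.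
  by apply: cvgD; [apply: (cvg0_bounded_mul bA)|apply: (cvg0_bounded_mul bB)];
    rewrite -(addr0 (0 : R)); exact: cvgD.
have hS2 : S2 n @[n --> \oo] --> (0 + 0 + 0 * 0 - 0 * 0 : R).
  apply: cvgB; last exact: cvgM.
  apply: cvgD; last exact: cvgM.
  by apply: cvgD; [apply: (cvg0_bounded_mul bA)|apply: (cvg0_bounded_mul bB)];
    rewrite -(subr0 (0 : R)); exact: cvgB.
have hsD : sin (D n) @[n --> \oo] --> sin (kappa ^+ 2 * (b - a)).
  by apply: continuous_cvg; [exact: continuous_sin|exact: hD].
have hcD : cos (D n) @[n --> \oo] --> cos (kappa ^+ 2 * (b - a)).
  by apply: continuous_cvg; [exact: continuous_cos|exact: hD].
have lim : kappa^-1 * (S1 n * sin (D n) + S2 n * cos (D n)) @[n --> \oo] -->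
    e * sin (kappa ^+ 2 * (b - a)).
  have -> : e * sin (kappa ^+ 2 * (b - a)) = kappa^-1 *
    ((kappa * e + (0 + 0 + 0 * 0 + 0 * 0)) * sin (kappa ^+ 2 * (b - a)) +
    (0 + 0 + 0 * 0 - 0 * 0) * cos (kappa ^+ 2 * (b - a))).
    by field; rewrite gt_eqF.
  by apply: cvgMl_tmp; apply: cvgD; [exact: cvgM hsD|exact: cvgM hcD].
apply: (cvg_near_eq lim); apply: nearW => n /=.
have k0' : kappa != 0 by rewrite gt_eqF.
have -> : S1 n = rotA n (al n) * rotA n (be n) + rotB n (al n) * rotB n (be n).
  by rewrite /S1 /uA' /uB' /vA' /vB' /A0 /B0' /osc_energy -/kappa; field.
have -> : S2 n = rotA n (al n) * rotB n (be n) - rotB n (al n) * rotA n (be n).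
  by rewrite /S2 /uA' /uB' /vA' /vB' /A0 /B0'; ring.
rewrite /D sinB cosB /rotA /rotB.
have := cos2Dsin2 (L n * kappa ^+ 2 * al n).
have := cos2Dsin2 (L n * kappa ^+ 2 * be n).
move: (cos _) (sin _) (cos _) (sin _) => c s c' s' h1 h2.
(* Undoing both rotations produces the factors [cos^2 + sin^2], which are inserted on the right so
   that [field] can conclude. *)
rewrite -[RHS]mulr1 -[X in _ = _ * X]mulr1 -{1}h1 -h2.
by field.
Qed.

End Oscillation.

(** * Gaussian moments and Wallis' formula *)

Section GaussMoments.
Context {R : realType}.
Let mu := @lebesgue_measure R.
Implicit Types (a n : nat) (x : R).

Definition gauss_weight x : R := expR (- (x ^+ 2 / 2)).

Lemma is_derive_gauss_weight x :
  is_derive x (1 : R) gauss_weight (- x * gauss_weight x).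
Proof.
have h : is_derive x (1 : R) (fun z : R => - (z ^+ 2 / 2)) (- x).
  by apply: is_derive_eq; rewrite /GRing.scale /=; lra.
apply: (is_derive_eq (@is_derive1_comp R expR _ x _ _ (is_derive_expR _) h)).
exact: mulrC.
Qed.

Lemma gauss_weight_ge0 x : 0 <= gauss_weight x. Proof. exact: expR_ge0. Qed.

Lemma continuous_gauss_weight : continuous gauss_weight.
Proof.
move=> x; apply: differentiable_continuous; apply/derivable1_diffP.
by have [] := is_derive_gauss_weight x.
Qed.

Let f a x : R := `|x| ^+ a * gauss_weight x.

Let f_ge0 a x : 0 <= f a x.
Proof. by rewrite mulr_ge0 ?exprn_ge0 ?gauss_weight_ge0. Qed.

Let continuous_f a : continuous (f a).
Proof.
move=> x; apply: cvgM; last exact: continuous_gauss_weight.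
apply: (@continuous_comp _ _ _ (fun z : R => `|z|) (fun z => z ^+ a)).
  exact: norm_continuous.
exact: exprn_continuous.
Qed.

Let measurable_f a : measurable_fun setT (f a).
Proof. by apply: continuous_measurable_fun; exact: continuous_f. Qed.

Let integrable_f_itv a (n : R) : mu.-integrable `[0, n] (EFin \o f a).
Proof.
apply: continuous_compact_integrable; first exact: segment_compact.
by apply: continuous_subspaceT; exact: continuous_f.
Qed.

(** The value of the integral of [x^a exp(-x^2/2)] over the half-line, defined by its two step
    recursion; see [integral_half_moment]. *)
Fixpoint half_moment a : R :=
  if a is b.+1 then if b is c.+1 then b%:R * half_moment c else 1
  else Num.sqrt (2 * pi) / 2.

Lemma half_moment0 : half_moment 0 = Num.sqrt (2 * pi) / 2. Proof. by []. Qed.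

Lemma half_moment1 : half_moment 1 = 1. Proof. by []. Qed.

Lemma half_momentSS a : half_moment a.+2 = a.+1%:R * half_moment a.
Proof. by []. Qed.

Let tail_cvg0 a : f a n%:R @[n --> \oo] --> 0.
Proof.
apply: (@cvg0_norm_le _ _ harmonic); last exact: cvg_harmonic.
near=> n; rewrite ger0_norm// /f /harmonic /=.
(* Then [n^a exp(-n^2/2) <= exp(a n - n^2/2) <= exp(-n)] as soon as [n >= 2 (a + 1)]. *)
have h : (n%:R : R) ^+ a <= expR (a%:R * n%:R).
  rewrite expRM_natl lerXn2r ?nnegrE ?expR_ge0//.
  by apply: le_trans (expR_ge1Dx _); rewrite lerDr.
rewrite (ger0_norm (ler0n _ _)) -natr1 addrC.
apply: (@le_trans _ _ (expR (- n%:R))).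
  apply: le_trans (ler_wpM2r (gauss_weight_ge0 _) h) _.
  rewrite /gauss_weight -expRD ler_expR.
  have h2 : 2 * (a%:R + 1) <= n%:R :> R.
    by rewrite natr1 -natrM ler_nat; near: n; exists (2 * a.+1)%N.
  have h3 : 2 * (a%:R + 1) * n%:R <= n%:R * n%:R :> R by rewrite ler_wpM2r.
  by rewrite expr2; lra.
rewrite expRN lef_pV2 ?posrE ?expR_gt0 ?ltr_pwDl//.
exact: expR_ge1Dx.
Unshelve. all: by end_near. Qed.

Let derive_power_gauss a x : is_derive x (1 : R) (fun z : R => z ^+ a.+1 * gauss_weight z)
  (a.+1%:R * (x ^+ a * gauss_weight x) - x ^+ a.+2 * gauss_weight x).
Proof.
have h1 : is_derive x (1 : R) (fun z : R => z ^+ a.+1) (a.+1%:R * x ^+ a).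
  have h := @is_deriveX R _ id a.+1 x 1 1 (is_derive_id x 1).
  rewrite exprfctE in h.
  by apply: (is_derive_eq h); rewrite /GRing.scale /= mulr1.
apply: (is_derive_eq (is_deriveM h1 (is_derive_gauss_weight x))).
by rewrite /GRing.scale /= [x ^+ a.+2]exprS; ring.
Qed.

Let FTC_itv (F g : R -> R) n : (forall x, is_derive x (1 : R) F (g x)) ->
  continuous g -> (0 < n)%N ->
  \int[mu]_(x in `[0, n%:R]) g x = F n%:R - F 0.
Proof.
move=> Fg cg n0; have n0R : 0 < n%:R :> R by rewrite ltr0n.
rewrite /Rintegral (@continuous_FTC2 _ g F)//.
- exact: continuous_subspaceT.
- have cF x : F z @[z --> x] --> F x.
    apply: differentiable_continuous; apply/derivable1_diffP.
    by have [] := Fg x.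
  split => [x _||].
  + by have [] := Fg x.
  + exact: cvg_at_right_filter.
  + exact: cvg_at_left_filter.
- by move=> x _; rewrite derive1E; have [_ ->] := Fg x.
Qed.

Let continuous_mono a : continuous (fun x => x ^+ a * gauss_weight x).
Proof.
by move=> x; apply: cvgM; [exact: exprn_continuous|exact: continuous_gauss_weight].
Qed.

Let eq_f_itv a n : \int[mu]_(x in `[0, n%:R]) f a x =
  \int[mu]_(x in `[0, n%:R]) (x ^+ a * gauss_weight x).
Proof.
apply: eq_Rintegral => x; rewrite inE /= in_itv /= => /andP[x0 _].
by rewrite /f ger0_norm.
Qed.

Let integrable_mono a (n : R) :
  mu.-integrable `[0, n] (EFin \o (fun x => x ^+ a * gauss_weight x)).
Proof.
apply: continuous_compact_integrable; first exact: segment_compact.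
by apply: continuous_subspaceT; exact: continuous_mono.
Qed.

Let by_parts_itv a n : (0 < n)%N ->
  \int[mu]_(x in `[0, n%:R]) f a.+2 x =
  a.+1%:R * \int[mu]_(x in `[0, n%:R]) f a x - f a.+1 n%:R.
Proof.
move=> n0.
have cg : continuous (fun x => a.+1%:R * (x ^+ a * gauss_weight x) - x ^+ a.+2 * gauss_weight x).
  move=> x; apply: cvgB; last exact: continuous_mono.
  by apply: cvgMl_tmp; exact: continuous_mono.
have := FTC_itv (derive_power_gauss a) cg n0.
rewrite expr0n /= mul0r subr0 !eq_f_itv /f ger0_norm// => <-.
have ia : mu.-integrable `[0, n%:R]
    (EFin \o (fun x => a.+1%:R * (x ^+ a * gauss_weight x))).
  apply: continuous_compact_integrable; first exact: segment_compact.
  by apply: continuous_subspaceT => x; apply: cvgMl_tmp; exact: continuous_mono.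
rewrite RintegralB//.
rewrite RintegralZl//.
by rewrite opprB addrC subrK.
Qed.

Let by_parts_itv0 n : (0 < n)%N ->
  \int[mu]_(x in `[0, n%:R]) f 1 x = 1 - f 0 n%:R.
Proof.
move=> n0; rewrite eq_f_itv.
have dF x : is_derive x (1 : R) (fun x => - gauss_weight x) (x ^+ 1 * gauss_weight x).
  apply: (is_derive_eq (is_deriveN (is_derive_gauss_weight x))).
  by rewrite expr1 mulNr opprK.
rewrite (FTC_itv dF (@continuous_mono 1) n0) /f expr0 mul1r.
by rewrite /gauss_weight expr0n /= mul0r oppr0 expR0 opprK addrC.
Qed.

Let integral_f_fin a (n : R) :
  (\int[mu]_(x in `[0%R, n]) (f a x)%:E = (\int[mu]_(x in `[0, n]) f a x)%:E)%E.
Proof. by rewrite fineK// integrable_fin_num//; exact: integrable_f_itv. Qed.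

Lemma integral_half_moment a :
  (\int[mu]_(x in `[0%R, +oo[) (`|x| ^+ a * gauss_weight x)%:E = (half_moment a)%:E)%E.
Proof.
suff [] : (\int[mu]_(x in `[0%R, +oo[) (f a x)%:E = (half_moment a)%:E)%E /\
  (\int[mu]_(x in `[0%R, +oo[) (f a.+1 x)%:E = (half_moment a.+1)%:E)%E by [].
elim: a => [|a [ih1 ih2]]; split => //.
- have := @integral_normal_pdf R 0 1.
  rewrite ge0_symfun_integralT; last 3 first.
  + exact: normal_pdf_ge0.
  + exact/continuous_normal_pdf/oner_neq0.
  + move=> x /=; rewrite normal_pdfE ?oner_neq0//=.
    by rewrite /normal_fun !subr0 sqrrN.
  have -> : [set x : R | 0 <= x] = `[0, +oo[%classic.
    by apply/seteqP; split => x /=; rewrite in_itv /= andbT.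
  move=> h.
  have {h} hp : (\int[mu]_(x in `[0%R, +oo[) (normal_pdf 0 1 x)%:E = (1 / 2)%:E)%E.
    (* The equation says that twice an extended real is [1], which excludes the infinite values. *)
    move: h; rewrite -/mu; case: (X in (2 * X)%E) => [r||].
    + by rewrite -EFinM => -[h]; congr EFin; lra.
    + by rewrite gt0_muley.
    + by rewrite gt0_muleNy.
  have pk0 : normal_peak 1 != 0 :> R by rewrite gt_eqF// normal_peak_gt0// oner_neq0.
  under eq_integral => x _.
    have -> : f 0 x = (normal_peak 1)^-1 * normal_pdf 0 1 x.
      rewrite normal_pdfE ?oner_neq0// mulKf// /normal_fun /f expr0 mul1r subr0.
      rewrite expr1n /gauss_weight -mulNr; congr (expR (_ / _)).
    rewrite EFinM.
    over.
  rewrite ge0_integralZl//=; last 3 first.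
  + by apply/measurable_EFinP/measurable_funTS; exact: measurable_normal_pdf.
  + by move=> x _; rewrite lee_fin normal_pdf_ge0.
  + by rewrite lee_fin invr_ge0 normal_peak_ge0.
  rewrite hp -EFinM; congr EFin; rewrite /normal_peak invrK expr1n mul1r.
  by rewrite [in RHS]mulr_natl; ring.
- have /cvg_lim <- // := ge0_cvgn_integral (mu := mu) (f_ge0 1) (measurable_f 1).
  apply/cvg_lim => //.
  under eq_fun do rewrite integral_f_fin.
  apply: cvg_EFin; first by apply: nearW.
  have lim : 1 - f 0 n%:R @[n --> \oo] --> (1 - 0 : R).
    by apply: cvgB; [exact: cvg_cst|exact: tail_cvg0].
  rewrite subr0 in lim; apply: (cvg_near_eq lim).
  by exists 1%N => // n /= n0; rewrite by_parts_itv0.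
- have /cvg_lim <- // := ge0_cvgn_integral (mu := mu) (f_ge0 a.+2) (measurable_f a.+2).
  apply/cvg_lim => //.
  have := ge0_cvgn_integral (mu := mu) (f_ge0 a) (measurable_f a).
  rewrite ih1 => /fine_cvgP[_ ha].
  under eq_fun do rewrite integral_f_fin.
  apply: cvg_EFin; first by apply: nearW.
  have lim : a.+1%:R * \int[mu]_(x in `[0, n%:R]) f a x - f a.+1 n%:R @[n --> \oo] -->
    (a.+1%:R * half_moment a - 0 : R).
    by apply: cvgB; [exact: cvgMl_tmp|exact: tail_cvg0].
  rewrite subr0 in lim; apply: (cvg_near_eq lim).
  by exists 1%N => // n /= n0; rewrite by_parts_itv.
Qed.

End GaussMoments.

Arguments half_moment {R} a : simpl never.

Section Wallis.
Context {R : realType}.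
Let mu := @lebesgue_measure R.
Implicit Types (a n m : nat) (x : R).

Local Notation A := (@half_moment R).

Lemma half_moment_gt0 a : 0 < half_moment a :> R.
Proof.
suff [] : 0 < half_moment a :> R /\ 0 < half_moment a.+1 :> R by [].
elim: a => [|a [ih1 ih2]].
  by rewrite half_moment0 half_moment1 divr_gt0// sqrtr_gt0 mulr_gt0// pi_gt0.
by rewrite half_momentSS mulr_gt0.
Qed.

Lemma measurable_gauss_moment a :
  measurable_fun setT (fun x : R => `|x| ^+ a * gauss_weight x).
Proof.
apply: continuous_measurable_fun => x.
apply: cvgM; last exact: continuous_gauss_weight.
apply: (@continuous_comp _ _ _ (fun z : R => `|z|) (fun z => z ^+ a)).
  exact: norm_continuous.
exact: exprn_continuous.
Qed.

Lemma gauss_moment_ge0 a x : 0 <= `|x| ^+ a * gauss_weight x.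
Proof. by rewrite mulr_ge0 ?exprn_ge0 ?gauss_weight_ge0. Qed.

(* Cauchy-Schwarz, from [0 <= x^a (x - l)^2]. *)
Lemma half_moment_log_convex a :
  half_moment a.+1 ^+ 2 <= half_moment a * half_moment a.+2 :> R.
Proof.
have A0 := half_moment_gt0 a; have A1 := half_moment_gt0 a.+1.
pose l : R := A a.+1 / A a.
have l0 : 0 <= l by rewrite divr_ge0// ltW.
have Z b k : 0 <= k -> (\int[mu]_(x in `[0%R, +oo[) (k * (`|x| ^+ b * gauss_weight x))%:E =
    (k * A b)%:E)%E.
  move=> k0; under eq_integral do rewrite EFinM.
  rewrite ge0_integralZl//=; last 2 first.
  - by apply/measurable_EFinP/measurable_funTS; exact: measurable_gauss_moment.
  - by move=> x _; rewrite lee_fin gauss_moment_ge0.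
  by rewrite integral_half_moment.
have mZ b k : measurable_fun (`[0%R, +oo[%classic : set (measurableTypeR R))
    (fun x : measurableTypeR R => (k * (`|x| ^+ b * gauss_weight x))%:E).
  apply/measurable_EFinP/measurable_funTS; apply: measurable_funM => //.
  exact: measurable_gauss_moment.
have : ((2 * l * A a.+1)%:E <= (1 * A a.+2)%:E + (l ^+ 2 * A a)%:E)%E.
  have l20 : 0 <= 2 * l by rewrite mulr_ge0.
  rewrite -!Z ?sqr_ge0//.
  rewrite -ge0_integralD//=; last 2 first.
  - by move=> x _; rewrite lee_fin mulr_ge0 ?gauss_moment_ge0.
  - by move=> x _; rewrite lee_fin mulr_ge0 ?gauss_moment_ge0 ?sqr_ge0.
  apply: ge0_le_integral => //=.
  - by move=> x _; rewrite lee_fin; apply: mulr_ge0 => //; exact: gauss_moment_ge0.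
  - by apply: emeasurable_funD; exact: mZ.
  - move=> x _; rewrite -EFinD lee_fin -subr_ge0.
    have -> : 1 * (`|x| ^+ a.+2 * gauss_weight x) + l ^+ 2 * (`|x| ^+ a * gauss_weight x) -
      2 * l * (`|x| ^+ a.+1 * gauss_weight x) =
      (`|x| - l) ^+ 2 * (`|x| ^+ a * gauss_weight x) by rewrite !exprS; ring.
    by rewrite mulr_ge0 ?sqr_ge0 ?gauss_moment_ge0.
rewrite -EFinD lee_fin => h.
have e1 : 2 * l * A a.+1 * A a = 2 * A a.+1 ^+ 2 by rewrite /l; field; rewrite gt_eqF.
have e2 : l ^+ 2 * A a * A a = A a.+1 ^+ 2 by rewrite /l; field; rewrite gt_eqF.
have := ler_wpM2r (ltW A0) h; lra.
Qed.

(** Wallis' inequalities: log-convexity at two consecutive indices, combined with the two step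
    recursion, squeezes the ratio of neighbouring moments. *)
Lemma half_moment_ratio_bounds n :
  n.+1%:R^-1 <= (half_moment n / half_moment n.+1) ^+ 2 :> R /\
  n%:R * (half_moment n / half_moment n.+1) ^+ 2 <= 1 :> R.
Proof.
have A0 := half_moment_gt0 n; have A1 := half_moment_gt0 n.+1.
rewrite expr_div_n; split.
  rewrite ler_pdivlMr ?exprn_gt0// ler_pdivrMl//.
  by have := half_moment_log_convex n; rewrite half_momentSS expr2; lra.
rewrite mulrA ler_pdivrMr ?exprn_gt0// mul1r.
case: n A0 A1 => [|n] A0 A1; first by rewrite mul0r exprn_ge0 ?ltW.
have := half_moment_log_convex n.
rewrite half_momentSS => h; rewrite exprMn.
by have := ler_wpM2l (ler0n R n.+1) h; lra.
Qed.

Lemma hermite_odd0 m : hermite m.*2.+1 0 = 0 :> R.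
Proof.
elim: m => [|m ih]; first by rewrite hermite1.
by rewrite doubleS hermiteS mul0r ih mulr0 subrr.
Qed.

(** Both sides equal [1] at [m = 0] and are multiplied by [(2m+1) / (2m+2)] when [m] increases by
    one. *)
Lemma hermite_even0 m : hermite m.*2 0 ^+ 2 / m.*2`!%:R =
  half_moment m.*2 / half_moment m.*2.+1 / half_moment 0 :> R.
Proof.
elim: m => [|m ih].
  by rewrite double0 hermite0 half_moment1 fact0 expr1n !divr1 divff// gt_eqF// half_moment_gt0.
rewrite doubleS [hermite _ _]hermiteS mul0r sub0r /= 2!half_momentSS !factS !natrM.
have -> : half_moment m.*2 = hermite m.*2 0 ^+ 2 / m.*2`!%:R * half_moment m.*2.+1 * half_moment 0 :> R.
  by rewrite ih; field; rewrite !gt_eqF ?half_moment_gt0.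
have f0 := factS_neq0 (R := R) m.*2.
have h1 : half_moment m.*2.+1 != 0 :> R by rewrite gt_eqF// half_moment_gt0.
have h0 : half_moment 0 != 0 :> R by rewrite gt_eqF// half_moment_gt0.
have n1 : m.*2.+1%:R != 0 :> R by [].
have n2 : m.*2.+2%:R != 0 :> R by [].
move: (half_moment _) h1 (half_moment _) h0 f0 n1 n2.
move: (m.*2.+1%:R) (m.*2.+2%:R) (m.*2`!%:R) => a b c u hu v hv c0 a0 b0.
by field; rewrite hu hv c0 a0 b0.
Qed.

End Wallis.

(** * Asymptotics of the Hermite kernel *)

Section HermiteOscillator.
Context {R : realType}.
Implicit Types (N n m : nat) (t : R).

Definition osc_freq N : R := N%:R + 1 / 2.
Local Notation nu := osc_freq.

Lemma osc_freq_gt0 N : 0 < nu N.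
Proof. by rewrite ltr_wpDl. Qed.

Lemma osc_freq_neq0 N : nu N != 0.
Proof. by rewrite gt_eqF// osc_freq_gt0. Qed.

Lemma sqrt_osc_freq_gt0 N : 0 < Num.sqrt (nu N).
Proof. by rewrite sqrtr_gt0 osc_freq_gt0. Qed.

Lemma sqrt_osc_freq_neq0 N : Num.sqrt (nu N) != 0.
Proof. by rewrite gt_eqF// sqrt_osc_freq_gt0. Qed.

Lemma sqr_sqrt_osc_freq N : Num.sqrt (nu N) ^+ 2 = nu N.
Proof. by rewrite sqr_sqrtr// ltW// osc_freq_gt0. Qed.

Definition osc_point N t : R := 2 * Num.sqrt (nu N) * cos t.

(** The [N!] is that of Christoffel-Darboux; [sqrt(nu)] compensates the decay of [He_N(0)^2 / N!]
    for even [N], so that the energy has a finite nonzero limit. *)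
Definition osc_scale N : R := Num.sqrt (Num.sqrt (nu N) / N`!%:R).

Lemma sqr_osc_scale N : osc_scale N ^+ 2 = Num.sqrt (nu N) / N`!%:R.
Proof. by rewrite sqr_sqrtr// divr_ge0// sqrtr_ge0. Qed.

Lemma osc_scale_neq0 N : osc_scale N != 0.
Proof.
by rewrite gt_eqF// sqrtr_gt0 divr_gt0 ?sqrt_osc_freq_gt0// ltr0n fact_gt0.
Qed.

(* Liouville-Green variables in the angle [t], [x = 2 sqrt(nu) cos t]: the equation of
   [hermite_fun] becomes the system of [AdiabaticInvariant] with [L = 2 nu]. *)
Definition osc_y N t : R := osc_scale N * hermite_fun N (osc_point N t).
Definition osc_p N t : R :=
  osc_scale N / Num.sqrt (nu N) * hermite_fun' N (osc_point N t).

Lemma is_derive_osc_point N t :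
  is_derive t (1 : R) (osc_point N) (- (2 * Num.sqrt (nu N) * sin t)).
Proof.
apply: (is_derive_eq (is_deriveM (is_derive_cst (2 * Num.sqrt (nu N)) t 1) (is_derive_cos t))).
by rewrite /GRing.scale /= mulr0 addr0 mulrN.
Qed.

Lemma is_derive_osc_y N t :
  is_derive t (1 : R) (osc_y N) (- (2 * nu N) * sin t * osc_p N t).
Proof.
have h := @is_derive1_comp R _ _ t _ _ (is_derive_hermite_fun N _) (is_derive_osc_point N t).
apply: (is_derive_eq (is_deriveM (is_derive_cst (osc_scale N) t 1) h)).
rewrite /GRing.scale /= mulr0 addr0 /osc_p -[X in _ = - (2 * X) * _ * _]sqr_sqrt_osc_freq.
by field; exact: sqrt_osc_freq_neq0.
Qed.

Lemma is_derive_osc_p N t :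
  is_derive t (1 : R) (osc_p N) (2 * nu N * sin t ^+ 3 * osc_y N t).
Proof.
have h := @is_derive1_comp R _ _ t _ _ (is_derive_hermite_fun' N _) (is_derive_osc_point N t).
apply: (is_derive_eq (is_deriveM (is_derive_cst (osc_scale N / Num.sqrt (nu N)) t 1) h)).
rewrite /GRing.scale /= mulr0 addr0 /osc_y -/(nu N).
have -> : nu N - osc_point N t ^+ 2 / 4 = nu N * sin t ^+ 2.
  by rewrite sin2cos2 /osc_point !exprMn sqr_sqrt_osc_freq; field.
rewrite -[X in _ = 2 * X * _ * _]sqr_sqrt_osc_freq -[X in - (X * _)]sqr_sqrt_osc_freq.
by field; exact: sqrt_osc_freq_neq0.
Qed.

Lemma hermite_fun_oscE N t : hermite_fun N (osc_point N t) = osc_y N t / osc_scale N.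
Proof. by rewrite /osc_y mulrC mulKf// osc_scale_neq0. Qed.

Lemma hermite_fun'_oscE N t :
  hermite_fun' N (osc_point N t) = Num.sqrt (nu N) * osc_p N t / osc_scale N.
Proof. by rewrite /osc_p; field; rewrite sqrt_osc_freq_neq0 osc_scale_neq0. Qed.

Lemma invr_sqr_osc_scale N : (osc_scale N)^-1 ^+ 2 / N`!%:R = (Num.sqrt (nu N))^-1.
Proof.
rewrite exprVn sqr_osc_scale; field.
by rewrite sqrt_osc_freq_neq0 factS_neq0.
Qed.

Lemma osc_energy_pihalf N : osc_energy (osc_y N) (osc_p N) (pi / 2) =
  Num.sqrt (nu N) * ((hermite N 0 ^+ 2 + N%:R ^+ 2 * hermite N.-1 0 ^+ 2 / nu N) / N`!%:R).
Proof.
rewrite /osc_energy sin_pihalf divr1 mul1r /osc_p /osc_y /osc_point cos_pihalf mulr0.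
rewrite /hermite_fun' /hermite_fun expr0n /= !(mul0r, oppr0) expR0 !mulr1 add0r.
rewrite !exprMn sqr_osc_scale exprVn sqr_sqrt_osc_freq.
by field; rewrite osc_freq_neq0 factS_neq0.
Qed.

Let h0 : R := half_moment 0.

Let h0_gt0 : 0 < h0. Proof. exact: half_moment_gt0. Qed.

(** By parity only one of [He_N(0)], [He_(N-1)(0)] is nonzero, and [hermite_even0] expresses its
    square by a ratio of moments. The two cases give [N^2 r^2 / nu] and [nu r^2] for the square; the
    bounds cover both. *)
Let energy_bounds N : (2 <= N)%N ->
  N%:R / N.+1%:R <= (osc_energy (osc_y N) (osc_p N) (pi / 2) * h0) ^+ 2
     <= N.+1%:R / N.-1%:R.
Proof.
move=> N2; rewrite osc_energy_pihalf.
have nu0 := osc_freq_gt0 N.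
have n1 : 1 < N%:R :> R by rewrite ltr1n.
have N0 : (0 < N)%N by exact: leq_trans N2.
have pN : N.-1%:R = N%:R - 1 :> R by rewrite -subn1 natrB.
rewrite pN -(@natr1 _ N).
have -> (X : R) : (Num.sqrt (nu N) * X * h0) ^+ 2 = nu N * (X * h0) ^+ 2.
  by rewrite !exprMn sqr_sqrt_osc_freq; ring.
have := odd_double_half N; case: (odd N) => /= NE.
- have [q1 q2] := half_moment_ratio_bounds (R := R) N./2.*2.
  have Nh : N.-1 = N./2.*2 by rewrite -{1}NE.
  have HN : hermite N 0 = 0 :> R by rewrite -NE hermite_odd0.
  rewrite -Nh prednK// pN in q1 q2.
  have HN1 := hermite_even0 (R := R) N./2.
  rewrite -Nh prednK// -/h0 in HN1.
  set r := half_moment N.-1 / half_moment N in q1 q2 HN1.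
  rewrite HN expr0n /= add0r.
  have -> : (N%:R ^+ 2 * hermite N.-1 0 ^+ 2 / nu N / N`!%:R * h0) = N%:R / nu N * r.
    have -> : r = hermite N.-1 0 ^+ 2 / N.-1`!%:R * h0.
      by rewrite HN1 divfK// gt_eqF.
    have -> : N`!%:R = N%:R * N.-1`!%:R :> R by rewrite -natrM -{1}(prednK N0) factS prednK.
    by field; rewrite osc_freq_neq0 factS_neq0 gt_eqF//; lra.
  have -> : nu N * (N%:R / nu N * r) ^+ 2 = N%:R ^+ 2 * r ^+ 2 / nu N.
    by field; exact: osc_freq_neq0.
  move: q1 q2; rewrite /osc_freq in nu0 *; move: n1 nu0 (r ^+ 2) => + + q.
  move: (N%:R) => n n1 nu0 q1 q2.
  apply/andP; split.
    rewrite ler_pdivlMr// mulrAC ler_pdivrMr; last by lra.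
    have : n ^+ 2 / n <= n ^+ 2 * q by rewrite ler_wpM2l ?sqr_ge0.
    by rewrite expr2 mulfK ?gt_eqF; nra.
  rewrite ler_pdivrMr// [leRHS]mulrAC ler_pdivlMr; last by lra.
  have := ler_wpM2l (sqr_ge0 n) q2; nra.
- have [q1 q2] := half_moment_ratio_bounds (R := R) N./2.*2.
  have HN1 := hermite_even0 (R := R) N./2.
  rewrite add0n in NE; rewrite NE -/h0 in q1 q2 HN1.
  have -> : hermite N.-1 0 = 0 :> R.
    have := hermite_odd0 (R := R) N./2.-1.
    suff -> : (N./2.-1.*2.+1 = N.-1)%N by [].
    by rewrite -{2}NE; case: (N./2) NE => [|k] //= e; rewrite -e in N0.
  rewrite expr0n /= mulr0 mul0r addr0.
  rewrite HN1 divfK ?gt_eqF//; set r := half_moment N / half_moment N.+1.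
  rewrite -/r in q1 q2; rewrite -natr1 in q1.
  move: q1 q2; rewrite /osc_freq in nu0 *; move: n1 nu0 (r ^+ 2) => + + q.
  move: (N%:R) => n n1 nu0 q1 q2.
  have q0 : 0 <= q by apply: le_trans q1; rewrite invr_ge0; lra.
  apply/andP; split.
    have : n / (n + 1) <= n * q by rewrite ler_wpM2l//; lra.
    nra.
  rewrite ler_pdivlMr; last by lra.
  have := ler_wpM2l q0 (ltW n1); nra.
Qed.

Lemma osc_energy_pihalf_cvg :
  osc_energy (osc_y N) (osc_p N) (pi / 2) @[N --> \oo] --> h0^-1.
Proof.
have lim : (osc_energy (osc_y N) (osc_p N) (pi / 2) * h0) ^+ 2 @[N --> \oo] --> (1 : R).
  rewrite -(cvg_shiftn 2).
  have hh : harmonic n @[n --> \oo] --> (0 : R) := cvg_harmonic.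
  (* With [N = n + 2] and [harmonic n = 1 / (n + 1)] the upper bound is exactly [1 + 2 / (n + 1)],
     while the lower one is [1 - 1 / (n + 3)]. *)
  apply: (squeeze_cvgr (f := fun n => 1 - harmonic n) (h := fun n => 1 + 2 * harmonic n)).
  - apply: nearW => n /=; have := energy_bounds (leq_addl n 2).
    rewrite addn2 /= /harmonic /= => /andP[lo up]; apply/andP; split.
      apply: le_trans lo; rewrite -!natr1.
      rewrite ler_pdivlMr; last by rewrite !ltr_wpDl.
      have n1 : 0 < n%:R + 1 :> R by rewrite ltr_wpDl.
      have := divff (lt0r_neq0 n1); have : 0 <= (n%:R + 1 : R)^-1 by rewrite invr_ge0 ltW.
      nra.
    apply: le_trans up _; rewrite -!natr1.
    have n1 : 0 < n%:R + 1 :> R by rewrite ltr_wpDl.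
    have := divff (lt0r_neq0 n1); nra.
  - rewrite -[X in _ --> X](subr0 1); apply: cvgB; [exact: cvg_cst|exact: hh].
  - rewrite -[X in _ --> X](addr0 1) -[X in _ --> _ + X](mulr0 2).
    by apply: cvgD; [exact: cvg_cst|exact: cvgMl_tmp].
have lim1 : Num.sqrt ((osc_energy (osc_y N) (osc_p N) (pi / 2) * h0) ^+ 2)
    @[N --> \oo] --> (1 : R).
  by rewrite -[X in _ --> X]sqrtr1; apply: continuous_cvg; [exact: sqrt_continuous|exact: lim].
rewrite -[X in _ --> X]mul1r; apply: (cvg_near_eq (cvgMr_tmp (b := h0^-1) lim1)).
apply: nearW => N /=; rewrite sqrtr_sqr ger0_norm ?mulfK ?gt_eqF//.
by rewrite mulr_ge0 ?(ltW h0_gt0)// osc_energy_ge0// sin_pihalf.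
Qed.

End HermiteOscillator.

Lemma hermite_funN {R : realType} n (x : R) :
  hermite_fun n (- x) = (-1) ^+ n * hermite_fun n x.
Proof. by rewrite /hermite_fun hermiteN sqrrN mulrA. Qed.

Lemma hermite_fun'N {R : realType} n (x : R) :
  hermite_fun' n (- x) = - (-1) ^+ n * hermite_fun' n x.
Proof.
rewrite /hermite_fun' !hermite_funN; case: n => [|n].
  by rewrite expr0 !mul0r; ring.
by rewrite /= exprS; ring.
Qed.

(** * Limits of the Hermite kernel at angles within [O(1/nu)] of [phi] *)

Section KernelLimits.
Context {R : realType}.
Local Notation nu := (@osc_freq R).
Local Notation h0 := (@half_moment R 0).

Variables (phi a b : R) (al be : nat -> R).
Hypothesis phi_itv : 0 < phi < pi / 2.
Hypothesis ha : 2 * nu N * al N @[N --> \oo] --> a.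
Hypothesis hb : 2 * nu N * be N @[N --> \oo] --> b.

Let kappa : R := sin phi.

Let s N := osc_point N (phi + al N).
Let t N := osc_point N (phi + be N).

Lemma osc_freq_cvgy : 2 * nu N @[N --> \oo] --> +oo.
Proof.
apply/cvgryPge => M; near=> N.
have : M <= N%:R by near: N; exact: nbhs_infty_ger.
by rewrite /osc_freq; have := ler0n R N; lra.
Unshelve. all: by end_near. Qed.

Let inv_freq0 : (nu N)^-1 @[N --> \oo] --> (0 : R).
Proof.
have h : \forall N \near \oo, 0 < 2 * nu N.
  by apply: nearW => N; rewrite mulr_gt0// osc_freq_gt0.
have lim : 2 * (2 * nu N)^-1 @[N --> \oo] --> 2 * (0 : R).
  by apply: cvgMl_tmp; exact: ((gtr0_cvgV0 h).2 osc_freq_cvgy).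
rewrite mulr0 in lim; apply: (cvg_near_eq lim); apply: nearW => N /=.
by rewrite invfM mulrA divff// mul1r.
Qed.

Let phi_shift (c : R) (ga : nat -> R) : 2 * nu N * ga N @[N --> \oo] --> c ->
  phi + ga N @[N --> \oo] --> phi.
Proof.
move=> hc; rewrite -[X in _ --> X]addr0; apply: cvgD; first exact: cvg_cst.
exact: shift_cvg0 osc_freq_cvgy _ _ hc.
Qed.

Let bounded_osc (c : R) (ga : nat -> R) : 2 * nu N * ga N @[N --> \oo] --> c ->
  exists2 B : R, 0 < B & \forall N \near \oo,
    `|osc_y N (phi + ga N)| <= B /\ `|osc_p N (phi + ga N)| <= B.
Proof.
move=> hc.
have [B [B0 hB]] := osc_bounded is_derive_osc_y is_derive_osc_p osc_freq_cvgy
  osc_energy_pihalf_cvg phi_itv.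
exists B => //; near=> N.
have : phi / 2 <= phi + ga N <= pi / 2.
  apply/andP; split; near: N.
    by have /cvgr_ge := phi_shift hc; apply; have := phi_itv; lra.
  by have /cvgr_le := phi_shift hc; apply; have := phi_itv; lra.
by move: (phi + ga N); near: N.
Unshelve. all: by end_near. Qed.

Let bounded_div_freq (u v : nat -> R) (B : R) :
  (\forall N \near \oo, `|u N| <= B /\ `|v N| <= B) ->
  u N * v N * (nu N)^-1 @[N --> \oo] --> 0.
Proof.
move=> huv; apply: (cvg0_bounded_mul (B := B * B)) inv_freq0.
by apply: filterS huv => N [u1 v1]; rewrite normrM ler_pM.
Qed.

(** Linearization of [cos] at [phi]: the remainder has derivative [sin (phi + x) - kappa], of size
    at most [|x|], so it is [O(ga^2)] and survives the factor [2 nu] only as [O(|ga|)]. *)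
Let cos_shift (c : R) (ga : nat -> R) : 2 * nu N * ga N @[N --> \oo] --> c ->
  2 * nu N * (cos phi - cos (phi + ga N)) @[N --> \oo] --> kappa * c.
Proof.
move=> hc; have ga0 := shift_cvg0 osc_freq_cvgy hc.
have rem0 : 2 * nu N * (cos phi - cos (phi + ga N)) - kappa * (2 * nu N * ga N)
    @[N --> \oo] --> 0.
  apply: (@cvg0_norm_le _ _ (fun N => `|2 * nu N * ga N| * `|ga N|)); last first.
    rewrite -(mulr0 `|c|); apply: cvgM; first exact: cvg_norm.
    by rewrite -(@normr0 _ R); exact: cvg_norm.
  apply: nearW => N.
  pose f x := cos phi - cos (phi + x) - kappa * x.
  have df x : is_derive x (1 : R) f (sin (phi + x) - kappa).
    have ht : is_derive x (1 : R) (fun x : R => phi + x) 1.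
      apply: (is_derive_eq (is_deriveD (is_derive_cst phi x 1) (is_derive_id x 1))).
      by rewrite add0r.
    have hcos := @is_derive1_comp R cos _ x _ _ (is_derive_cos _) ht.
    apply: (is_derive_eq (is_deriveB (is_deriveB (is_derive_cst (cos phi) x 1) hcos)
      (is_deriveM (is_derive_cst kappa x 1) (is_derive_id x 1)))).
    by rewrite /GRing.scale /=; ring.
  have := @is_derive_norm_le _ f _ `|ga N| 0 (ga N) (fun x _ => df x).
  rewrite /f addr0 subrr mulr0 !subr0 => /(_ _)/wrap[].
    move=> x; rewrite subr0 => xg; apply: le_trans xg.
    by apply: le_trans (norm_sinB_le _ _) _; rewrite addrAC subrr add0r.
  move=> h; rewrite normrM.
  have -> : 2 * nu N * (cos phi - cos (phi + ga N)) - kappa * (2 * nu N * ga N) =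
    2 * nu N * (cos phi - cos (phi + ga N) - kappa * ga N) by ring.
  by rewrite normrM -mulrA ler_wpM2l.
have lim : (2 * nu N * (cos phi - cos (phi + ga N)) - kappa * (2 * nu N * ga N)) +
    kappa * (2 * nu N * ga N) @[N --> \oo] --> 0 + kappa * c.
  by apply: cvgD; [exact: rem0|exact: cvgMl_tmp].
rewrite add0r in lim.
by apply: (cvg_near_eq lim); apply: nearW => N /=; rewrite subrK.
Qed.

Let scaled_wronskian N x z : cos x != cos z ->
  hermite_kernel N (osc_point N x) (osc_point N z) *
   (expR (- (osc_point N x ^+ 2 / 4)) * expR (- (osc_point N z ^+ 2 / 4))) /
   Num.sqrt (nu N) =
  osc_y N x * osc_y N z * (nu N)^-1 * 2^-1 +
  (osc_y N x * osc_p N z - osc_p N x * osc_y N z) / (2 * nu N * (cos x - cos z)).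
Proof.
move=> xz; have xz0 : cos x - cos z != 0 by rewrite subr_eq0.
have s0 := sqrt_osc_freq_neq0 (R := R) N.
have sE : osc_point N x - osc_point N z = 2 * Num.sqrt (nu N) * (cos x - cos z).
  by rewrite /osc_point; ring.
have d0 : 2 * Num.sqrt (nu N) * (cos x - cos z) != 0 by rewrite !mulf_neq0.
have := hermite_kernel_wronskian N (osc_point N x) (osc_point N z).
rewrite sE !hermite_fun_oscE !hermite_fun'_oscE.
set K := hermite_kernel _ _ _ * _ => h; clear sE.
have -> : K = (2 * Num.sqrt (nu N) * (cos x - cos z))^-1 *
  ((2 * Num.sqrt (nu N) * (cos x - cos z)) / 2 * (osc_y N x * osc_y N z) +
   Num.sqrt (nu N) * (osc_y N x * osc_p N z - osc_p N x * osc_y N z)) *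
  ((osc_scale N)^-1 ^+ 2 / N`!%:R).
  apply: (mulfI d0); rewrite h; field.
  by rewrite xz0 s0 factS_neq0 osc_scale_neq0.
(* Generalizing [Num.sqrt (nu N)] to a variable [r] with [nu N = r ^+ 2] turns the goal into a
   rational identity. The same device recurs below. *)
clear h d0; rewrite invr_sqr_osc_scale; have nuE := esym (sqr_sqrt_osc_freq (R := R) N); move: s0 nuE.
by move: (Num.sqrt _) => r s0 ->; field; rewrite xz0 s0.
Qed.

(** For equal angles the Wronskian formula degenerates; its confluent form shows the energy itself,
    so that the value of [sinc] at [0] comes from [osc_energy_cvg]. *)
Let scaled_diag N x : sin x != 0 ->
  hermite_kernel N (osc_point N x) (osc_point N x) *
   (expR (- (osc_point N x ^+ 2 / 4)) * expR (- (osc_point N x ^+ 2 / 4))) /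
   Num.sqrt (nu N) =
  osc_y N x * osc_y N x * (nu N)^-1 * 2^-1 + sin x * osc_energy (osc_y N) (osc_p N) x.
Proof.
move=> sx0; have s0 := sqrt_osc_freq_neq0 (R := R) N.
rewrite -expr2 hermite_kernel_energy -/(nu N).
have -> : nu N - osc_point N x ^+ 2 / 4 = nu N * sin x ^+ 2.
  by rewrite sin2cos2 /osc_point !exprMn sqr_sqrt_osc_freq; field.
rewrite !hermite_fun_oscE !hermite_fun'_oscE.
transitivity ((osc_y N x ^+ 2 / 2 + nu N * osc_p N x ^+ 2 +
  nu N * sin x ^+ 2 * osc_y N x ^+ 2) * ((osc_scale N)^-1 ^+ 2 / N`!%:R) / Num.sqrt (nu N)).
  have nuE := esym (sqr_sqrt_osc_freq (R := R) N); move: s0 nuE; move: (Num.sqrt _) => r s0 ->.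
  by field; rewrite s0 factS_neq0 osc_scale_neq0.
rewrite invr_sqr_osc_scale /osc_energy; have nuE := esym (sqr_sqrt_osc_freq (R := R) N); move: s0 nuE.
by move: (Num.sqrt _) => r s0 ->; field; rewrite s0 sx0.
Qed.

Let e_ x : R := expR (- (x ^+ 2 / 4)).

Let norm_le_max (x B C : R) : `|x| <= B -> `|x| <= Num.max B C.
Proof. by move=> h; rewrite le_max h. Qed.

Let norm_le_maxr (x B C : R) : `|x| <= C -> `|x| <= Num.max B C.
Proof. by move=> h; rewrite le_max h orbT. Qed.

Let bounded_both : exists B : R, \forall N \near \oo,
  (`|osc_y N (phi + al N)| <= B /\ `|osc_p N (phi + al N)| <= B) /\
  (`|osc_y N (phi + be N)| <= B /\ `|osc_p N (phi + be N)| <= B).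
Proof.
have [B _ hB] := bounded_osc ha; have [C _ hC] := bounded_osc hb.
exists (Num.max B C); apply: filterS2 hB hC => N [y1 p1] [y2 p2].
by split; split; (apply: norm_le_max + apply: norm_le_maxr).
Qed.

Let yy0 : osc_y N (phi + al N) * osc_y N (phi + be N) * (nu N)^-1 @[N --> \oo] --> 0.
Proof.
have [B hB] := bounded_both; apply: (bounded_div_freq (B := B)).
by apply: filterS hB => N [[? ?] [? ?]].
Qed.

Lemma hermite_kernel_cvg : a != b ->
  hermite_kernel N (s N) (t N) * (e_ (s N) * e_ (t N)) / Num.sqrt (nu N) @[N --> \oo] -->
  h0^-1 * sin (kappa ^+ 2 * (b - a)) / (kappa * (b - a)).
Proof.
move=> ab.
have k0 : 0 < kappa by apply: sin_gt0_pihalf; have := phi_itv; lra.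
have kba0 : kappa * (b - a) != 0 by apply: mulf_neq0; [rewrite gt_eqF|rewrite subr_eq0 eq_sym].
have D : 2 * nu N * (cos (phi + al N) - cos (phi + be N)) @[N --> \oo] --> kappa * (b - a).
  rewrite mulrBr; apply: (cvg_near_eq (cvgB (cos_shift hb) (cos_shift ha))).
  by apply: nearW => N /=; rewrite !fctE; ring.
have W := osc_wronskian_cvg is_derive_osc_y is_derive_osc_p osc_freq_cvgy
  (@osc_energy_pihalf_cvg R) phi_itv ha hb.
have lim : osc_y N (phi + al N) * osc_y N (phi + be N) * (nu N)^-1 * 2^-1 +
   (osc_y N (phi + al N) * osc_p N (phi + be N) - osc_p N (phi + al N) * osc_y N (phi + be N)) /
   (2 * nu N * (cos (phi + al N) - cos (phi + be N))) @[N --> \oo] -->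
   0 * 2^-1 + h0^-1 * sin (kappa ^+ 2 * (b - a)) / (kappa * (b - a)).
  by apply: cvgD; [exact: cvgMr_tmp yy0|apply: cvgM => //; exact: cvgV].
rewrite mul0r add0r in lim; apply: (cvg_near_eq lim).
have Dneq : \forall N \near \oo, 2 * nu N * (cos (phi + al N) - cos (phi + be N)) != 0.
  by have /cvgr_neq0 := D; apply.
apply: filterS Dneq => N D0.
rewrite -scaled_wronskian//; apply: contra_neq D0 => ->.
by rewrite subrr mulr0.
Qed.

Let sin_neq0_near : \forall N \near \oo, sin (phi + al N) != 0.
Proof.
have k0 : 0 < kappa by apply: sin_gt0_pihalf; have := phi_itv; lra.
have lim : sin (phi + al N) @[N --> \oo] --> kappa.
  by apply: continuous_cvg; [exact: continuous_sin|exact: phi_shift ha].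
by have /cvgr_neq0 := lim; apply; rewrite gt_eqF.
Qed.

Lemma hermite_kernel_diag_cvg :
  hermite_kernel N (s N) (s N) * (e_ (s N) * e_ (s N)) / Num.sqrt (nu N) @[N --> \oo] -->
  h0^-1 * kappa.
Proof.
have [B _ hB] := bounded_osc ha.
have yy : osc_y N (phi + al N) * osc_y N (phi + al N) * (nu N)^-1 @[N --> \oo] --> 0.
  by apply: (bounded_div_freq (B := B)); apply: filterS hB => N [? ?].
have E := osc_energy_cvg is_derive_osc_y is_derive_osc_p osc_freq_cvgy
  (@osc_energy_pihalf_cvg R) phi_itv (phi_shift ha).
have S : sin (phi + al N) @[N --> \oo] --> kappa.
  by apply: continuous_cvg; [exact: continuous_sin|exact: phi_shift ha].
have lim : osc_y N (phi + al N) * osc_y N (phi + al N) * (nu N)^-1 * 2^-1 +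
   sin (phi + al N) * osc_energy (osc_y N) (osc_p N) (phi + al N) @[N --> \oo] -->
   0 * 2^-1 + kappa * h0^-1.
  by apply: cvgD; [exact: cvgMr_tmp|exact: cvgM].
rewrite mul0r add0r mulrC in lim; apply: (cvg_near_eq lim).
by apply: filterS sin_neq0_near => N s0; rewrite -scaled_diag.
Qed.

Let cos_cvg (c : R) (ga : nat -> R) : 2 * nu N * ga N @[N --> \oo] --> c ->
  cos (phi + ga N) @[N --> \oo] --> cos phi.
Proof.
move=> hc; apply: continuous_cvg; [exact: continuous_cos|exact: phi_shift hc].
Qed.

Let cos_phi_gt0 : 0 < cos phi.
Proof. by apply: cos_gt0_pihalf; have := phi_itv; lra. Qed.

(** In place of the small difference of cosines, the denominator contains their sum, which tends to
    [2 cos phi > 0]. After normalization bounded quantities divided by [nu] are left. *)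
Lemma hermite_kernelN_cvg0 :
  hermite_kernel N (s N) (- t N) * (e_ (s N) * e_ (t N)) / Num.sqrt (nu N) @[N --> \oo] --> 0.
Proof.
have [B hB] := bounded_both.
pose u N := osc_y N (phi + al N) * osc_y N (phi + be N) * (nu N)^-1 * 2^-1 -
  (osc_y N (phi + al N) * osc_p N (phi + be N) * (nu N)^-1 +
   osc_p N (phi + al N) * osc_y N (phi + be N) * (nu N)^-1) /
   (2 * (cos (phi + al N) + cos (phi + be N))).
have csum : cos (phi + al N) + cos (phi + be N) @[N --> \oo] --> cos phi + cos phi.
  by apply: cvgD; [exact: cos_cvg ha|exact: cos_cvg hb].
have c20 : cos phi + cos phi != 0 by rewrite gt_eqF// addr_gt0.
have lim : u N @[N --> \oo] --> 0 * 2^-1 - (0 + 0) / (2 * (cos phi + cos phi)).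
  apply: cvgB; first exact: cvgMr_tmp.
  apply: cvgM; last by apply: cvgV; [rewrite mulf_neq0|exact: cvgMl_tmp].
  by apply: cvgD; apply: (bounded_div_freq (B := B)); apply: filterS hB => N [[? ?] [? ?]].
rewrite mul0r addr0 mul0r subr0 in lim.
apply: (@cvg0_norm_le _ _ (fun N => `|u N|)); last first.
  by rewrite -(@normr0 _ R); exact: cvg_norm.
have cneq : \forall N \near \oo, cos (phi + al N) + cos (phi + be N) != 0.
  by have /cvgr_neq0 := csum; apply.
apply: filterS cneq => N c0.
have s0 := sqrt_osc_freq_neq0 (R := R) N.
suff -> : hermite_kernel N (s N) (- t N) * (e_ (s N) * e_ (t N)) / Num.sqrt (nu N) =
    (-1) ^+ N * u N by rewrite normrM normrX normrN1 expr1n mul1r.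
have sE : s N + t N = 2 * Num.sqrt (nu N) * (cos (phi + al N) + cos (phi + be N)).
  by rewrite /s /t /osc_point; ring.
have d0 : 2 * Num.sqrt (nu N) * (cos (phi + al N) + cos (phi + be N)) != 0.
  by rewrite !mulf_neq0.
have := hermite_kernel_wronskian N (s N) (- t N).
rewrite opprK sE hermite_funN hermite_fun'N sqrrN -/(e_ (s N)) -/(e_ (t N)).
rewrite /s /t !hermite_fun_oscE !hermite_fun'_oscE -/(s N) -/(t N).
set K := hermite_kernel _ _ _ * _ => h; clear sE.
have -> : K = (2 * Num.sqrt (nu N) * (cos (phi + al N) + cos (phi + be N)))^-1 *
  ((-1) ^+ N * ((2 * Num.sqrt (nu N) * (cos (phi + al N) + cos (phi + be N))) / 2 *
     (osc_y N (phi + al N) * osc_y N (phi + be N)) -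
   Num.sqrt (nu N) * (osc_y N (phi + al N) * osc_p N (phi + be N) +
     osc_p N (phi + al N) * osc_y N (phi + be N)))) *
  ((osc_scale N)^-1 ^+ 2 / N`!%:R).
  apply: (mulfI d0); rewrite h; field.
  by rewrite c0 s0 factS_neq0 osc_scale_neq0.
clear h d0; rewrite invr_sqr_osc_scale /u.
have nuE := esym (sqr_sqrt_osc_freq (R := R) N); move: s0 nuE.
by move: (Num.sqrt _) => r s0 ->; field; rewrite c0 s0.
Qed.

(** The boundary term of the odd part of the kernel. Its degree is [N] or [N + 1] according to
    parity, and both choices have to be estimated at the oscillator of index [N]. *)
Let edge (m : nat -> nat) :=
  hermite (m N) (s N) * hermite (m N) (t N) / (m N)`!%:R * (e_ (s N) * e_ (t N)) /
    (s N * t N) / Num.sqrt (nu N) @[N --> \oo] --> 0.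

Let inv_cos_cvg : (4 * (cos (phi + al N) * cos (phi + be N)))^-1 @[N --> \oo] -->
  (4 * (cos phi * cos phi))^-1.
Proof.
apply: cvgV; first by rewrite !mulf_neq0// gt_eqF.
by apply: cvgMl_tmp; apply: cvgM; [exact: cos_cvg ha|exact: cos_cvg hb].
Qed.

Lemma hermite_edge_cvg0 : edge id.
Proof.
have lim : osc_y N (phi + al N) * osc_y N (phi + be N) * (nu N)^-1 *
    ((4 * (cos (phi + al N) * cos (phi + be N)))^-1 * (nu N)^-1) @[N --> \oo] -->
    0 * ((4 * (cos phi * cos phi))^-1 * 0).
  by apply: cvgM => //; apply: cvgM.
rewrite mul0r in lim; apply: (cvg_near_eq lim); apply: nearW => N.
have s0 := sqrt_osc_freq_neq0 (R := R) N.
have hf x : hermite N x * e_ x = hermite_fun N x by [].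
transitivity (hermite_fun N (s N) * hermite_fun N (t N) / N`!%:R /
    (s N * t N) / Num.sqrt (nu N)); last by rewrite -!hf /=; ring.
rewrite /s /t !hermite_fun_oscE.
transitivity (osc_y N (phi + al N) * osc_y N (phi + be N) * ((osc_scale N)^-1 ^+ 2 / N`!%:R) /
  (osc_point N (phi + al N) * osc_point N (phi + be N)) / Num.sqrt (nu N)); last by ring.
rewrite invr_sqr_osc_scale /osc_point.
have nuE := esym (sqr_sqrt_osc_freq (R := R) N); move: s0 nuE.
move: (Num.sqrt _) => r s0 ->.
have -> : 2 * r * cos (phi + al N) * (2 * r * cos (phi + be N)) =
  r ^+ 2 * (4 * (cos (phi + al N) * cos (phi + be N))) by ring.
by move: (4 * _) => d; rewrite [in RHS]invfM; move: (d^-1) => c; field.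
Qed.

(** The raising relation [He_(N+1) exp(-x^2/4) = (x/2) w - w']: degree [N + 1] is controlled by the
    variables of index [N], at the points scaled with [nu N]. *)
Let hermiteS_oscE N x : hermite N.+1 (osc_point N x) * e_ (osc_point N x) =
  Num.sqrt (nu N) * (cos x * osc_y N x - osc_p N x) / osc_scale N.
Proof.
have s0 := sqrt_osc_freq_neq0 (R := R) N.
transitivity (osc_point N x / 2 * hermite_fun N (osc_point N x) - hermite_fun' N (osc_point N x)).
  by rewrite hermiteS /hermite_fun' /hermite_fun -/(e_ _); field.
rewrite hermite_fun_oscE hermite_fun'_oscE /osc_point.
by field; rewrite osc_scale_neq0.
Qed.

Lemma hermite_edgeS_cvg0 : edge succn.
Proof.
have [B hB] := bounded_both.
have lim : (cos (phi + al N) * osc_y N (phi + al N) - osc_p N (phi + al N)) *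
    (cos (phi + be N) * osc_y N (phi + be N) - osc_p N (phi + be N)) * (nu N)^-1 *
    ((4 * (cos (phi + al N) * cos (phi + be N)))^-1 * harmonic N) @[N --> \oo] -->
    0 * ((4 * (cos phi * cos phi))^-1 * 0).
  apply: cvgM; last by apply: cvgM => //; exact: cvg_harmonic.
  have cb (x y p : R) : `|y| <= B -> `|p| <= B -> `|cos x * y - p| <= B + B.
    move=> yB pB; apply: le_trans (ler_normB _ _) _; apply: lerD => //.
    by rewrite normrM -[leRHS]mul1r ler_pM// cos_max.
  apply: (bounded_div_freq (B := B + B)); apply: filterS hB => N [[? ?] [? ?]].
  by split; exact: cb.
rewrite mul0r in lim; apply: (cvg_near_eq lim); apply: nearW => N.
have s0 := sqrt_osc_freq_neq0 (R := R) N.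
have n0 : N.+1%:R != 0 :> R by rewrite pnatr_eq0.
transitivity ((hermite N.+1 (s N) * e_ (s N)) * (hermite N.+1 (t N) * e_ (t N)) / N.+1`!%:R /
    (s N * t N) / Num.sqrt (nu N)); last by rewrite /=; ring.
rewrite /s /t !hermiteS_oscE factS natrM [(N.+1%:R * _)^-1]invfM /harmonic /=.
set u := cos _ * _ - _; set v := cos _ * _ - _.
transitivity (Num.sqrt (nu N) ^+ 2 * (u * v) * ((osc_scale N)^-1 ^+ 2 / N`!%:R) / N.+1%:R /
  (osc_point N (phi + al N) * osc_point N (phi + be N)) / Num.sqrt (nu N)); last by ring.
rewrite invr_sqr_osc_scale /osc_point.
have nuE := esym (sqr_sqrt_osc_freq (R := R) N); move: s0 nuE.
move: (Num.sqrt _) => r s0 ->.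
have -> : 2 * r * cos (phi + al N) * (2 * r * cos (phi + be N)) =
  r ^+ 2 * (4 * (cos (phi + al N) * cos (phi + be N))) by ring.
move: (4 * _) (N.+1%:R^-1) => d h; rewrite [in RHS]invfM; move: (d^-1) => c.
by field.
Qed.

End KernelLimits.

(** * The Hermite kernel at the scaled points of the theorem *)

Section ScaledPoints.
Context {R : realType}.
Local Notation h0 := (@half_moment R 0).
Variables (phi sigma tau : R).
Hypothesis phi_itv : 0 < phi < pi / 2.

(** [N] is the degree [n + 1] of the Hermite kernel, so [N.-1] is the [n] of the theorem. *)
Let shift (c : R) (N : nat) : R := c / (2 * sin phi ^+ 2) * (1 / N.-1%:R).
Let s N := osc_point N (phi + shift sigma N).
Let t N := osc_point N (phi + shift tau N).
Let e_ (x : R) : R := expR (- (x ^+ 2 / 4)).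

Let sin_phi_gt0 : 0 < sin phi.
Proof. by apply: sin_gt0_pihalf; have := phi_itv; lra. Qed.

Lemma shift_cvg (c : R) : 2 * osc_freq N * shift c N @[N --> \oo] --> c / sin phi ^+ 2.
Proof.
rewrite -cvg_shiftS /=.
have inv0 : (n%:R : R)^-1 @[n --> \oo] --> (0 : R).
  have h : \forall n \near \oo, 0 < (n%:R : R) by exists 1%N => // n /=; rewrite ltr0n.
  exact: ((gtr0_cvgV0 h).2 (@cvgr_idn R)).
have lim : c / sin phi ^+ 2 + 3 / 2 * (c / sin phi ^+ 2) * n%:R^-1 @[n --> \oo] -->
    c / sin phi ^+ 2 + 3 / 2 * (c / sin phi ^+ 2) * 0.
  by apply: cvgD; [exact: cvg_cst|exact: cvgMl_tmp].
rewrite mulr0 addr0 in lim; apply: (cvg_near_eq lim).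
exists 1%N => // n /= n1; rewrite /shift /osc_freq /= -(@natr1 _ n).
have : n%:R != 0 :> R by rewrite pnatr_eq0 -lt0n.
by move: (n%:R) => x x0; field; rewrite x0 gt_eqF.
Qed.

(** The limits [a], [b] of the rescaled shifts are [sigma / sin^2 phi] and [tau / sin^2 phi], whence
    [kappa^2 (b - a) = tau - sigma]: this is the purpose of the [sin^2 phi] in the scaling. *)
Lemma hermite_kernel_sinc_cvg :
  hermite_kernel N (s N) (t N) * (e_ (s N) * e_ (t N)) / Num.sqrt (osc_freq N)
    @[N --> \oo] --> h0^-1 * sin phi * sinc (tau - sigma).
Proof.
rewrite /sinc subr_eq0; have [ts|ts] := eqVneq tau sigma.
  by rewrite mulr1 /t ts; exact: (hermite_kernel_diag_cvg phi_itv (@shift_cvg sigma)).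
have ab : sigma / sin phi ^+ 2 != tau / sin phi ^+ 2.
  apply: contra_neq ts => h.
  by apply/esym/(mulIf _ h); rewrite invr_eq0 expf_neq0// gt_eqF.
have := hermite_kernel_cvg phi_itv (@shift_cvg sigma) (@shift_cvg tau) ab.
congr (_ --> _); rewrite (_ : sin phi ^+ 2 * _ = tau - sigma); last first.
  by field; rewrite gt_eqF.
have : tau - sigma != 0 by rewrite subr_eq0.
by move=> h; field; rewrite h !gt_eqF ?half_moment_gt0.
Qed.

Lemma hermite_kernelN_scaled_cvg0 :
  hermite_kernel N (s N) (- t N) * (e_ (s N) * e_ (t N)) / Num.sqrt (osc_freq N)
    @[N --> \oo] --> 0.
Proof. exact: hermite_kernelN_cvg0 phi_itv (@shift_cvg sigma) (@shift_cvg tau). Qed.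

Lemma hermite_edge_scaled_cvg0 (m : nat -> nat) :
  (forall N, m N = N \/ m N = N.+1) ->
  hermite (m N) (s N) * hermite (m N) (t N) / (m N)`!%:R * (e_ (s N) * e_ (t N)) /
    (s N * t N) / Num.sqrt (osc_freq N) @[N --> \oo] --> 0.
Proof.
move=> hm.
have h1 := hermite_edge_cvg0 phi_itv (@shift_cvg sigma) (@shift_cvg tau).
have h2 := hermite_edgeS_cvg0 phi_itv (@shift_cvg sigma) (@shift_cvg tau).
pose edge m N := hermite m (s N) * hermite m (t N) / m`!%:R * (e_ (s N) * e_ (t N)) /
    (s N * t N) / Num.sqrt (osc_freq N).
apply: (@cvg0_norm_le _ _ (fun N => `|edge N N| + `|edge N.+1 N|)).
  apply: nearW => N; case: (hm N) => ->; first by rewrite lerDl.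
  by rewrite lerDr.
have -> : (0 : R) = 0 + 0 by rewrite addr0.
by apply: cvgD; rewrite -(@normr0 _ R); apply: cvg_norm; [exact: h1|exact: h2].
Qed.

Lemma osc_points_cvg :
  s N * t N / osc_freq N @[N --> \oo] --> 4 * cos phi ^+ 2.
Proof.
have cs c : cos (phi + shift c N) @[N --> \oo] --> cos phi.
  apply: continuous_cvg; first exact: continuous_cos.
  rewrite -[X in _ --> X]addr0; apply: cvgD; first exact: cvg_cst.
  by apply: (shift_cvg0 (@osc_freq_cvgy R) (@shift_cvg c)).
have lim : 4 * (cos (phi + shift sigma N) * cos (phi + shift tau N)) @[N --> \oo] -->
  4 * (cos phi * cos phi) by apply: cvgMl_tmp; exact: cvgM.
rewrite -expr2 in lim; apply: (cvg_near_eq lim); apply: nearW => N.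
rewrite /s /t /osc_point.
have nuE := esym (sqr_sqrt_osc_freq (R := R) N).
move: (sqrt_osc_freq_neq0 (R := R) N) nuE; move: (Num.sqrt _) => r r0 ->.
by field.
Qed.

End ScaledPoints.

(** * Integration over the pure quaternions *)

Section ProductIntegral.
Context d1 d2 (T1 : measurableType d1) (T2 : measurableType d2) (R : realType).
Variable m1 : {sigma_finite_measure set T1 -> \bar R}.
Variable m2 : {sigma_finite_measure set T2 -> \bar R}.
Variables (f : T1 -> R) (g : T2 -> R).
Hypotheses (intf : m1.-integrable setT (EFin \o f))
           (intg : m2.-integrable setT (EFin \o g)).

Let fg (x : T1 * T2) : R := f x.1 * g x.2.

Lemma integrable_prodM : (m1 \x m2)%E.-integrable setT (EFin \o fg).
Proof.
have mf := measurable_int _ intf; have mg := measurable_int _ intg.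
move/measurable_EFinP in mf; move/measurable_EFinP in mg.
apply/integrable12ltyP.
  apply/measurable_EFinP; apply: measurable_funM.
    exact: (measurableT_comp mf measurable_fst).
  exact: (measurableT_comp mg measurable_snd).
have E x : (\int[m2]_y `|(EFin \o fg) (x, y)| = (`|f x|)%:E * \int[m2]_y `|(g y)%:E|)%E.
  under eq_integral => y _ do rewrite /= /fg /= normrM EFinM.
  rewrite ge0_integralZl//=.
  by apply/measurable_EFinP; exact: measurableT_comp.
under eq_integral => x _ do rewrite E.
have [_ f_oo] := integrableP _ _ _ intf; have [_ g_oo] := integrableP _ _ _ intg.
have g_fin : (\int[m2]_y `|(g y)%:E|)%E \is a fin_num.
  by rewrite ge0_fin_numE// integral_ge0.
rewrite -(fineK g_fin) ge0_integralZr//=; last 2 first.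
- by apply/measurable_EFinP; exact: measurableT_comp.
- by rewrite lee_fin fine_ge0// integral_ge0.
have f_fin : (\int[m1]_x `|(f x)%:E|)%E \is a fin_num.
  by rewrite ge0_fin_numE// integral_ge0.
by rewrite -(fineK f_fin) -EFinM ltry.
Qed.

Lemma Rintegral_prodM :
  \int[(m1 \x m2)%E]_x fg x = (\int[m1]_x f x) * (\int[m2]_y g y).
Proof.
rewrite /Rintegral -integral12_prod_meas1; last exact: integrable_prodM.
have E x : fubini_F m2 (EFin \o fg) x = ((f x) * (\int[m2]_y g y))%:E.
  rewrite /fubini_F /= /fg /=; under eq_integral do rewrite EFinM.
  rewrite integralZl//= EFinM /Rintegral fineK//.
  exact: integrable_fin_num.
transitivity (\int[m1]_x (f x * (\int[m2]_y g y))).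
  by congr fine; apply: eq_integral => x _; exact: E.
by rewrite RintegralZr.
Qed.

End ProductIntegral.

Section PlaneMeasure.
Context {R : realType}.

(** Named in order to be registered as a sigma-finite measure: [leb3] is then a product to which
    [integrable_prodM] and [Rintegral_prodM] apply with [m1 := leb2]. *)
Definition leb2 := (@lebesgue_measure R \x @lebesgue_measure R)%E.

Let sigma_finite_leb2 : sigma_finite setT leb2.
Proof.
have /sigma_finiteP[F [TF ndF Foo]] := sigma_finiteT (@lebesgue_measure R).
exists (fun n => F n `*` F n) => [|n].
  apply/seteqP; split => // -[x y] _.
  have [[i _ Fx] [j _ Fy]] : (\bigcup_i F i) x /\ (\bigcup_i F i) y by rewrite -TF.
  by exists (maxn i j) => //; split;
    [move: x Fx|move: y Fy]; apply/subsetPset/ndF; rewrite (leq_maxl, leq_maxr).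
have [mF Fn_oo] := Foo n; split; first exact: measurableX.
by rewrite /leb2 product_measure1E// lte_mul_pinfty// ge0_fin_numE.
Qed.

HB.instance Definition _ := Measure.copy leb2 (@lebesgue_measure R \x @lebesgue_measure R)%E.
HB.instance Definition _ := Measure_isSigmaFinite.Build _ _ _ leb2 sigma_finite_leb2.

End PlaneMeasure.

Section GaussMoments1.
Context {R : realType}.
Let mu := @lebesgue_measure R.

Let abs_int a : (\int[mu]_x (`|x| ^+ a * gauss_weight x)%:E = (2 * half_moment a)%:E)%E.
Proof.
rewrite ge0_symfun_integralT.
- have -> : [set x : R | 0 <= x] = `[0, +oo[%classic.
    by apply/seteqP; split => x /=; rewrite in_itv /= andbT.
  by rewrite integral_half_moment -EFinM.
- exact: gauss_moment_ge0.
- move=> x; apply: cvgM; last exact: continuous_gauss_weight.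
  apply: (@continuous_comp _ _ _ (fun z : R => `|z|) (fun z => z ^+ a)).
    exact: norm_continuous.
  exact: exprn_continuous.
- by move=> x /=; rewrite normrN /gauss_weight sqrrN.
Qed.

Let abs_integrable a : mu.-integrable setT (fun x => (`|x| ^+ a * gauss_weight x)%:E).
Proof.
apply/integrableP; split; first by apply/measurable_EFinP; exact: measurable_gauss_moment.
under eq_integral => x _ do rewrite gee0_abs ?lee_fin ?gauss_moment_ge0//.
by rewrite abs_int ltry.
Qed.

Let measurable_mono a : measurable_fun setT (fun x : R => x ^+ a * gauss_weight x).
Proof.
apply: continuous_measurable_fun => x.
by apply: cvgM; [exact: exprn_continuous|exact: continuous_gauss_weight].
Qed.

Lemma integrable_gauss_moment a :
  mu.-integrable setT (EFin \o (fun x => x ^+ a * gauss_weight x)).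
Proof.
apply: le_integrable (abs_integrable a) => //; first by apply/measurable_EFinP; exact: measurable_mono.
move=> x _ /=; rewrite lee_fin !normrM !normrX normr_id.
by rewrite (ger0_norm (gauss_weight_ge0 x)).
Qed.

Definition gauss_moment a : R := if odd a then 0 else 2 * half_moment a.

Lemma integral_gauss_moment a : \int[mu]_x (x ^+ a * gauss_weight x) = gauss_moment a.
Proof.
rewrite /gauss_moment; case: ifP => [oa|ea]; last first.
  rewrite /Rintegral (_ : (\int[mu]_x _)%E = (2 * half_moment a)%:E)// -abs_int.
  apply: eq_integral => x _; congr (_ * _)%:E.
  by rewrite -normrX ger0_norm// exprn_even_ge0 ?ea.
(* For odd [a], [x^a + |x|^a] vanishes on the negative half-line and is [2 |x|^a] on the positive
   one. The sum thus has the same integral as [|x|^a] alone, which forces the odd moment to be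
   [0]. *)
have h : \int[mu]_x (x ^+ a * gauss_weight x + `|x| ^+ a * gauss_weight x) = 2 * half_moment a.
  transitivity (\int[mu]_x ((fun z => 2 * (`|z| ^+ a * gauss_weight z)) \_ `[0, +oo[) x).
    apply: eq_Rintegral => x _; rewrite patchE.
    have [x0|x0] := leP 0 x.
      by rewrite mem_set ?in_itv /= ?in_itv /= ?x0// ger0_norm//; ring.
    rewrite memNset; last by rewrite /= in_itv /= andbT; apply/negP; rewrite -ltNge.
    by rewrite ltr0_norm// exprNn -signr_odd oa expr1 mulN1r mulNr subrr.
  transitivity (\int[mu]_(x in `[0%R, +oo[) (2 * (`|x| ^+ a * gauss_weight x))).
    by rewrite [RHS]Rintegral_mkcond.
  rewrite /Rintegral; under eq_integral do rewrite EFinM.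
  rewrite ge0_integralZl//=; last 2 first.
  - by apply/measurable_EFinP/measurable_funTS; exact: measurable_gauss_moment.
  - by move=> x _; rewrite lee_fin gauss_moment_ge0.
  by rewrite integral_half_moment.
rewrite RintegralD// in h; [|exact: integrable_gauss_moment|exact: abs_integrable].
have h2 : \int[mu]_x (`|x| ^+ a * gauss_weight x) = 2 * half_moment a.
  by rewrite /Rintegral abs_int.
by apply: (addIr (2 * half_moment a)); rewrite add0r -{1}h2.
Qed.

Lemma gauss_momentSS a : gauss_moment a.+2 = a.+1%:R * gauss_moment a.
Proof.
by rewrite /gauss_moment /= negbK; case: ifP; rewrite ?mulr0// half_momentSS mulrCA.
Qed.

End GaussMoments1.

Section GaussMoments3.
Context {R : realType}.
Implicit Types (F G : R * R * R -> R).

Local Notation c0 := (Num.sqrt (2 * pi) : R).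

Lemma fgaussE (s : R) : fgauss s = c0^-1 ^+ 3 * gauss_weight s.
Proof.
have pi0 : 0 < 2 * pi :> R by rewrite mulr_gt0// pi_gt0.
rewrite /fgauss /gauss_weight mulNr; congr (_ * _).
have c00 : 0 < c0 by rewrite sqrtr_gt0.
apply/eqP; rewrite -(@eqrXn2 _ 2)// ?powR_ge0 ?exprn_ge0 ?invr_ge0 ?(ltW c00)//.
rewrite -exprM mulnC exprM exprVn sqr_sqrtr ?(ltW pi0)//.
rewrite -powR_mulrn ?powR_ge0// -powRrM.
have -> : - (3 / 2) * 2%:R = - 3%:R :> R by field.
by rewrite powRN powR_mulrn ?(ltW pi0)// exprVn.
Qed.

Lemma fgauss_pureq (x : R * R * R) : fgauss `|pureq x| =
  (c0^-1 * gauss_weight x.1.1) * (c0^-1 * gauss_weight x.1.2) * (c0^-1 * gauss_weight x.2).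
Proof.
rewrite fgaussE /gauss_weight [`|_| ^+ 2]sqr_sqrtr ?qsqnorm_ge0//.
rewrite /qsqnorm /= expr0n /= add0r.
rewrite !mulrDl !opprD !expRD; ring.
Qed.

(** Integrability and value are carried together so that linearity holds without side conditions. *)
Definition gint3 F (c : R) : Prop :=
  (@leb3 R).-integrable setT (EFin \o (fun x => fgauss `|pureq x| * F x)) /\
  \int[@leb3 R]_x (fgauss `|pureq x| * F x) = c.

Lemma gint3_ext F G c : F =1 G -> gint3 F c -> gint3 G c.
Proof. by move=> /funext ->. Qed.

Lemma gint3D F G c d : gint3 F c -> gint3 G d -> gint3 (fun x => F x + G x) (c + d).
Proof.
move=> [i1 <-] [i2 <-]; split.
  pose u x := fgauss `|pureq x| * F x; pose v x := fgauss `|pureq x| * G x.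
  have -> : EFin \o (fun x => fgauss `|pureq x| * (F x + G x)) =
      (fun x => ((u x)%:E + (v x)%:E)%E).
    by apply/funext => x /=; rewrite /u /v -EFinD mulrDr.
  exact: (integrableD measurableT i1 i2).
by under eq_Rintegral do rewrite mulrDr; rewrite RintegralD.
Qed.

Lemma gint3Z F c k : gint3 F c -> gint3 (fun x => k * F x) (k * c).
Proof.
move=> [i1 <-]; split.
  pose u x := fgauss `|pureq x| * F x.
  have -> : EFin \o (fun x => fgauss `|pureq x| * (k * F x)) = (fun x => (k%:E * (u x)%:E)%E).
    by apply/funext => x /=; rewrite /u -EFinM mulrCA.
  exact: (integrableZl measurableT k i1).
by under eq_Rintegral do rewrite mulrCA; rewrite RintegralZl.
Qed.

Lemma gint3_0 : gint3 (fun=> 0) 0.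
Proof.
split; last by under eq_Rintegral do rewrite mulr0; rewrite /Rintegral integral0.
by rewrite (_ : EFin \o _ = cst 0%E); [exact: integrable0|apply/funext => x /=; rewrite mulr0].
Qed.

Definition gauss_moment3 a b c : R :=
  (c0^-1 * gauss_moment a) * (c0^-1 * gauss_moment b) * (c0^-1 * gauss_moment c).

Lemma gint3_mono a b c :
  gint3 (fun x => x.1.1 ^+ a * x.1.2 ^+ b * x.2 ^+ c) (gauss_moment3 a b c).
Proof.
pose w n (z : R) := c0^-1 * (z ^+ n * gauss_weight z).
have iw n : (@lebesgue_measure R).-integrable setT (EFin \o w n).
  pose u (z : R) := z ^+ n * gauss_weight z.
  have -> : EFin \o w n = (fun z => ((c0^-1)%:E * (u z)%:E)%E).
    by apply/funext => x /=; rewrite /w /u -EFinM.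
  exact: (integrableZl measurableT _ (integrable_gauss_moment n)).
have vw n : \int[@lebesgue_measure R]_z w n z = c0^-1 * gauss_moment n.
  by rewrite RintegralZl//; [rewrite integral_gauss_moment|exact: integrable_gauss_moment].
have E : (fun x : R * R * R => fgauss `|pureq x| * (x.1.1 ^+ a * x.1.2 ^+ b * x.2 ^+ c)) =
    (fun x => (w a x.1.1 * w b x.1.2) * w c x.2).
  by apply/funext => x; rewrite fgauss_pureq /w; ring.
have i12 : (@leb2 R).-integrable setT (EFin \o (fun x => w a x.1 * w b x.2)).
  exact: integrable_prodM (iw a) (iw b).
have i3 := integrable_prodM (m1 := @leb2 R) i12 (iw c).
have v3 := Rintegral_prodM (m1 := @leb2 R) i12 (iw c).
split; first by rewrite E.
rewrite E; apply: (etrans v3).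
by rewrite (Rintegral_prodM (iw a) (iw b)) !vw.
Qed.

Lemma gauss_moment3_000 : gauss_moment3 0 0 0 = 1.
Proof.
have c00 : c0 != 0 by rewrite gt_eqF// sqrtr_gt0 mulr_gt0// pi_gt0.
have -> : gauss_moment3 0 0 0 = (c0^-1 * (2 * half_moment 0)) ^+ 3.
  by rewrite /gauss_moment3 /gauss_moment /=; ring.
by rewrite half_moment0 (_ : 2 * (c0 / 2) = c0) ?mulVf ?expr1n//; field.
Qed.

(** Expanding one factor [|x|^2] raises one of the three exponents by two, and the one dimensional
    recursions add up to [(a+1) + (b+1) + (c+1)]. The exponents are general because the induction
    changes them. *)
Lemma gint3_radial a b c m :
  gint3 (fun x => x.1.1 ^+ a * x.1.2 ^+ b * x.2 ^+ c *
                  (x.1.1 ^+ 2 + x.1.2 ^+ 2 + x.2 ^+ 2) ^+ m)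
    (gauss_moment3 a b c * \prod_(j < m) (a + b + c + 3 + j.*2)%:R).
Proof.
elim: m a b c => [|m ih] a b c.
  rewrite big_ord0 mulr1; apply: gint3_ext (gint3_mono a b c) => x.
  by rewrite expr0 mulr1.
have h := gint3D (gint3D (ih a.+2 b c) (ih a b.+2 c)) (ih a b c.+2).
rewrite big_ord_recl /= addn0; set S := (a + b + c + 3)%N.
have -> : gauss_moment3 a b c * (S%:R * \prod_(i < m) (S + (bump 0 i).*2)%:R) =
    gauss_moment3 a.+2 b c * \prod_(j < m) (a.+2 + b + c + 3 + j.*2)%:R +
    gauss_moment3 a b.+2 c * \prod_(j < m) (a + b.+2 + c + 3 + j.*2)%:R +
    gauss_moment3 a b c.+2 * \prod_(j < m) (a + b + c.+2 + 3 + j.*2)%:R.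
  have e1 (T : nat) : T = (S + 2)%N -> \prod_(j < m) (T + j.*2)%:R =
      \prod_(i < m) (S + (bump 0 i).*2)%:R :> R.
    move=> ->; apply: eq_bigr => i _; congr (_%:R).
    by rewrite /bump /= doubleS; lia.
  rewrite !e1 /S; [|lia..].
  by rewrite /gauss_moment3 !gauss_momentSS !natrD -!natr1; ring.
apply: gint3_ext h => x.
by rewrite !(exprS _ m) !(exprS _ a.+1) !(exprS _ a) !(exprS _ b.+1) !(exprS _ b)
  !(exprS _ c.+1) !(exprS _ c); ring.
Qed.

End GaussMoments3.

Section QuaternionIntegral.
Context {R : realType}.
Local Notation H := (quat R).
Implicit Types (F G : H -> H) (a b c : H) (p q : {poly H}).

Lemma pureq_expr2 (x : R * R * R) :
  pureq x ^+ 2 = - (x.1.1 ^+ 2 + x.1.2 ^+ 2 + x.2 ^+ 2)%:A.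
Proof. by rewrite expr2; congr Quat => /=; ring. Qed.

Lemma qconj_pureq (x : R * R * R) : qconj (pureq x) = - pureq x.
Proof. by congr Quat => /=; ring. Qed.

Lemma qconjM a b : qconj (a * b) = qconj b * qconj a.
Proof. by case: a b => ? ? ? ? [? ? ? ?]; congr Quat => /=; ring. Qed.

Lemma qconjD a b : qconj (a + b) = qconj a + qconj b.
Proof. by congr Quat => /=; ring. Qed.

Lemma qconj0 : qconj (0 : H) = 0.
Proof. by congr Quat => /=; ring. Qed.

Lemma qconj1 : qconj (1 : H) = 1.
Proof. by congr Quat => /=; ring. Qed.

Lemma qconjK : involutive (@qconj R).
Proof. by move=> a; case: a => ? ? ? ?; congr Quat => /=; ring. Qed.

Lemma qconjX a n : qconj (a ^+ n) = qconj a ^+ n.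
Proof. by elim: n => [|n ih]; [exact: qconj1|rewrite exprS exprSr qconjM ih]. Qed.

Lemma qconj_sum I (r : seq I) (E : I -> H) :
  qconj (\sum_(i <- r) E i) = \sum_(i <- r) qconj (E i).
Proof. exact: (big_morph _ qconjD qconj0). Qed.

Definition qintegral G c : Prop :=
  [/\ gint3 (fun x => qre (G (pureq x))) (qre c),
      gint3 (fun x => qi (G (pureq x))) (qi c),
      gint3 (fun x => qj (G (pureq x))) (qj c) &
      gint3 (fun x => qk (G (pureq x))) (qk c)].

Lemma qintegral_qint G c : qintegral G c -> qint G = c.
Proof.
by case: c => c0 c1 c2 c3 [[_ /= <-] [_ /= <-] [_ /= <-] [_ /= <-]].
Qed.

Lemma qintegral_ext F G c : (forall x, F (pureq x) = G (pureq x)) ->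
  qintegral F c -> qintegral G c.
Proof.
by move=> FG [h0 h1 h2 h3]; split;
  [apply: gint3_ext h0|apply: gint3_ext h1|apply: gint3_ext h2|apply: gint3_ext h3] => x;
  rewrite FG.
Qed.

Lemma qintegralD F G c d : qintegral F c -> qintegral G d ->
  qintegral (fun z => F z + G z) (c + d).
Proof.
by move=> [h0 h1 h2 h3] [g0 g1 g2 g3]; split; exact: gint3D.
Qed.

Lemma qintegral0 : qintegral (fun=> 0) 0.
Proof. by split; exact: gint3_0. Qed.

Lemma qintegral_sum n (F : 'I_n -> H -> H) (c : 'I_n -> H) :
  (forall i, qintegral (F i) (c i)) ->
  qintegral (fun z => \sum_i F i z) (\sum_i c i).
Proof.
elim: n F c => [|n ih] F c h.
  by rewrite big_ord0; apply: qintegral_ext qintegral0 => x; rewrite big_ord0.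
rewrite big_ord_recl; apply: qintegral_ext (qintegralD (h ord0) (ih _ _ (fun i => h (lift ord0 i)))).
by move=> x; rewrite big_ord_recl.
Qed.

Lemma gint3_lin4 (F0 F1 F2 F3 : R * R * R -> R) (k0 k1 k2 k3 c0 c1 c2 c3 : R) :
  gint3 F0 c0 -> gint3 F1 c1 -> gint3 F2 c2 -> gint3 F3 c3 ->
  gint3 (fun x => k0 * F0 x + k1 * F1 x + k2 * F2 x + k3 * F3 x)
        (k0 * c0 + k1 * c1 + k2 * c2 + k3 * c3).
Proof.
by move=> h0 h1 h2 h3; apply: gint3D; [apply: gint3D; [apply: gint3D|]|]; exact: gint3Z.
Qed.

Lemma qintegral_mull a G c : qintegral G c -> qintegral (fun z => a * G z) (a * c).
Proof.
case: a => a0 a1 a2 a3 [h0 h1 h2 h3]; split => /=.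
- rewrite -!mulNr; apply: gint3_ext (gint3_lin4 a0 (- a1) (- a2) (- a3) h0 h1 h2 h3) => x.
  by rewrite -!mulNr.
- have := gint3_lin4 a0 a1 a2 (- a3) h1 h0 h3 h2; rewrite !mulNr.
  by apply: gint3_ext => x; rewrite !mulNr.
- have := gint3_lin4 a0 (- a1) a2 a3 h2 h3 h0 h1; rewrite !mulNr.
  by apply: gint3_ext => x; rewrite !mulNr.
- have := gint3_lin4 a0 a1 (- a2) a3 h3 h2 h1 h0; rewrite !mulNr.
  by apply: gint3_ext => x; rewrite !mulNr.
Qed.

Lemma qintegral_conj G c : qintegral G c -> qintegral (fun z => qconj (G z)) (qconj c).
Proof.
have N (F : R * R * R -> R) k : gint3 F k -> gint3 (fun x => - F x) (- k).
  by move=> /(gint3Z (- 1)); rewrite mulN1r; apply: gint3_ext => x; rewrite mulN1r.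
by move=> [h0 h1 h2 h3]; split; [exact: h0|exact: N h1|exact: N h2|exact: N h3].
Qed.

(** Conjugation exchanges left and right multiplication. *)
Lemma qintegral_mulr a G c : qintegral G c -> qintegral (fun z => G z * a) (c * a).
Proof.
move=> /qintegral_conj/(qintegral_mull (qconj a))/qintegral_conj.
rewrite qconjM !qconjK; apply: qintegral_ext => x.
by rewrite qconjM !qconjK.
Qed.

(** The integral of [z^n], which is real; see [qintegral_expr]. *)
Fixpoint pure_moment n : R :=
  if n is m.+1 then if m is l.+1 then - (m.+2)%:R * pure_moment l else 0 else 1.

Lemma pure_momentSS n : pure_moment n.+2 = - n.+3%:R * pure_moment n.
Proof. by []. Qed.

Arguments pure_moment : simpl never.

Lemma pure_moment_odd m : pure_moment m.*2.+1 = 0.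
Proof. by elim: m => [//|m ih]; rewrite doubleS pure_momentSS ih mulr0. Qed.

Lemma pure_moment_even m :
  pure_moment m.*2 = (-1) ^+ m * \prod_(j < m) (3 + j.*2)%:R.
Proof.
elim: m => [|m ih]; first by rewrite big_ord0 mulr1.
by rewrite doubleS pure_momentSS ih big_ord_recr /= exprS addnC addn3; ring.
Qed.

Lemma gauss_moment3_odd (i j k : nat) : odd i || odd j || odd k ->
  gauss_moment3 i j k = 0 :> R.
Proof.
rewrite /gauss_moment3 /gauss_moment; case: (odd i); first by rewrite mulr0 !mul0r.
case: (odd j); first by rewrite mulr0 mulr0 mul0r.
by case: (odd k) => //; rewrite !mulr0.
Qed.

(** As [z^2 = - |z|^2], even powers are real radial functions, and odd powers are [z] times such a
    function, so each of their components is odd in a coordinate. *)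
Lemma qintegral_expr n : qintegral (fun z => z ^+ n) (pure_moment n)%:A.
Proof.
pose g (x : R * R * R) := x.1.1 ^+ 2 + x.1.2 ^+ 2 + x.2 ^+ 2.
have ge (x : R * R * R) m : pureq x ^+ m.*2 = ((-1) ^+ m * g x ^+ m)%:A.
  rewrite -mul2n exprM pureq_expr2 -/(g x) -scaleNr.
  by rewrite exprZn expr1n (exprNn (g x)).
rewrite -(odd_double_half n); move: n./2 => m; case: (odd n).
  have odd0 (i j k : nat) : odd i || odd j || odd k ->
      gint3 (fun x => (-1) ^+ m * (x.1.1 ^+ i * x.1.2 ^+ j * x.2 ^+ k * g x ^+ m)) 0.
    move=> ijk; have := gint3Z ((-1) ^+ m) (gint3_radial (R := R) i j k m).
    by rewrite gauss_moment3_odd// mul0r mulr0.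
  rewrite [(true + _)%N]add1n pure_moment_odd scale0r.
  have E (x : R * R * R) : pureq x ^+ m.*2.+1 = ((-1) ^+ m * g x ^+ m) *: pureq x.
    by rewrite exprS ge -scalerAr mulr1.
  split.
  - by apply: gint3_ext (@gint3_0 R) => x; rewrite E /= mulr0.
  - by apply: gint3_ext (odd0 1 0 0 isT) => x; rewrite E /=; ring.
  - by apply: gint3_ext (odd0 0 1 0 isT) => x; rewrite E /=; ring.
  - by apply: gint3_ext (odd0 0 0 1 isT) => x; rewrite E /=; ring.
rewrite [(false + _)%N]add0n pure_moment_even; split.
- have := gint3Z ((-1) ^+ m) (gint3_radial (R := R) 0 0 0 m).
  rewrite gauss_moment3_000 mul1r /= mulr1; apply: gint3_ext => x.
  by rewrite ge /g /=; ring.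
- by rewrite /= mulr0; apply: gint3_ext (@gint3_0 R) => x; rewrite ge /= mulr0.
- by rewrite /= mulr0; apply: gint3_ext (@gint3_0 R) => x; rewrite ge /= mulr0.
- by rewrite /= mulr0; apply: gint3_ext (@gint3_0 R) => x; rewrite ge /= mulr0.
Qed.

Lemma peval_widen p m (z : H) : (size p <= m)%N ->
  peval p z = \sum_(k < m) z ^+ k * p`_k.
Proof.
move=> pm; rewrite /peval (big_ord_widen m (fun k => z ^+ k * p`_k) pm).
rewrite big_mkcond; apply: eq_bigr => i _; case: ifP => // /negbT.
by rewrite -leqNgt => h; rewrite nth_default// mulr0.
Qed.

Lemma pevalD p q (z : H) : peval (p + q) z = peval p z + peval q z.
Proof.
pose m := maxn (size p) (size q).
rewrite (@peval_widen (p + q) m) ?(size_polyD p q)// (@peval_widen p m) ?leq_maxl//.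
rewrite (@peval_widen q m) ?leq_maxr// -big_split /=.
by apply: eq_bigr => i _; rewrite coefD mulrDr.
Qed.

Lemma pevalN p (z : H) : peval (- p) z = - peval p z.
Proof.
rewrite (@peval_widen (- p) (size p)) ?size_polyN// /peval -sumrN.
by apply: eq_bigr => i _; rewrite coefN mulrN.
Qed.

Lemma pevalMn p (n : nat) (z : H) : peval (p *+ n) z = peval p z *+ n.
Proof.
elim: n => [|n ih]; last by rewrite !mulrS pevalD ih.
by rewrite !mulr0n /peval size_poly0 big_ord0.
Qed.

Lemma peval1 (z : H) : peval 1 z = 1.
Proof. by rewrite /peval size_poly1 big_ord1 expr0 mul1r coef1. Qed.

Lemma pevalXM p (z : H) : peval ('X * p) z = z * peval p z.
Proof.
rewrite (@peval_widen ('X * p) (size p).+1) -commr_polyX ?size_polyMXn//; last first.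
  by have [->|p0] := eqVneq p 0; rewrite ?mul0r ?size_poly0// size_mulX.
rewrite big_ord_recl /= coefMX /= mulr0 add0r /peval mulr_sumr.
by apply: eq_bigr => i _; rewrite coefMX /= /bump /= exprS mulrA.
Qed.

Lemma pevalMC p a (z : H) : peval (p * a%:P) z = peval p z * a.
Proof.
rewrite (@peval_widen (p * a%:P) (size p)); last first.
  by apply/leq_sizeP => j pj; rewrite coefMC nth_default// mul0r.
by rewrite /peval mulr_suml; apply: eq_bigr => i _; rewrite coefMC mulrA.
Qed.

Definition qform p q : H := qinner (peval p) (peval q).

(** On pure quaternions [qconj z = - z], so the integrand is a finite sum of terms
    [qconj p_i (-1)^i z^(i+j) q_j]. Integrability being settled here once, identities for [qform]
    follow from pointwise identities. *)
Lemma qintegral_qform p q :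
  qintegral (fun z => qconj (peval p z) * peval q z) (qform p q).
Proof.
have [c hc] : exists c, qintegral (fun z => qconj (peval p z) * peval q z) c.
  exists (\sum_(i < size p) \sum_(j < size q)
    qconj p`_i * (((-1) ^+ i * (pure_moment (i + j))%:A) * q`_j)).
  apply: (qintegral_ext (F := fun z => \sum_(i < size p) \sum_(j < size q)
    qconj p`_i * (((-1) ^+ i * z ^+ (i + j)) * q`_j))).
    move=> x; rewrite /peval qconj_sum mulr_suml; apply: eq_bigr => i _.
    rewrite mulr_sumr; apply: eq_bigr => j _.
    by rewrite qconjM qconjX qconj_pureq (exprNn (pureq x)) exprD !mulrA.
  apply: qintegral_sum => i; apply: qintegral_sum => j.
  apply: qintegral_mull; apply: qintegral_mulr; apply: qintegral_mull.
  exact: qintegral_expr.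
by rewrite /qform /qinner (qintegral_qint hc).
Qed.

Lemma qform_ext p q p' q' :
  (forall x, qconj (peval p (pureq x)) * peval q (pureq x) =
             qconj (peval p' (pureq x)) * peval q' (pureq x)) ->
  qform p q = qform p' q'.
Proof.
by move=> h; apply: esym; exact: (qintegral_qint (qintegral_ext h (qintegral_qform p q))).
Qed.

Lemma qformDr p q1 q2 : qform p (q1 + q2) = qform p q1 + qform p q2.
Proof.
apply: qintegral_qint.
apply: qintegral_ext (qintegralD (qintegral_qform p q1) (qintegral_qform p q2)) => x.
by rewrite pevalD mulrDr.
Qed.

Lemma qformC p q : qform q p = qconj (qform p q).
Proof.
apply: qintegral_qint; apply: qintegral_ext (qintegral_conj (qintegral_qform p q)) => x.
by rewrite qconjM qconjK.
Qed.

Lemma qformDl p1 p2 q : qform (p1 + p2) q = qform p1 q + qform p2 q.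
Proof. by rewrite qformC qformDr qconjD -!qformC. Qed.

Lemma qform0r p : qform p 0 = 0.
Proof. by apply: (addrI (qform p 0)); rewrite -qformDr !addr0. Qed.

Lemma qformNr p q : qform p (- q) = - qform p q.
Proof. by apply: (addrI (qform p q)); rewrite -qformDr !addrN qform0r. Qed.

Lemma qformMnr p q n : qform p (q *+ n) = qform p q *+ n.
Proof. by elim: n => [|n ih]; rewrite ?mulr0n ?qform0r// !mulrS qformDr ih. Qed.

Lemma qformMCr p q a : qform p (q * a%:P) = qform p q * a.
Proof.
apply: qintegral_qint; apply: qintegral_ext (qintegral_mulr a (qintegral_qform p q)) => x.
by rewrite pevalMC mulrA.
Qed.

(* Multiplication by the variable is antisymmetric, since [qconj z = - z]. *)
Lemma qformXl p q : qform ('X * p) q = - qform p ('X * q).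
Proof.
rewrite -qformNr; apply: qform_ext => x.
by rewrite pevalN !pevalXM qconjM qconj_pureq !mulrN mulNr -mulrA.
Qed.

Lemma qform1l q m : (size q <= m)%N ->
  qform 1 q = \sum_(j < m) (pure_moment j)%:A * q`_j.
Proof.
move=> qm; apply: qintegral_qint.
have h (j : 'I_m) : qintegral (fun z => z ^+ j * q`_j) ((pure_moment j)%:A * q`_j).
  exact/qintegral_mulr/qintegral_expr.
apply: qintegral_ext (qintegral_sum h) => x.
by rewrite peval1 qconj1 mul1r (peval_widen _ qm).
Qed.

End QuaternionIntegral.

Arguments pure_moment {R} n : simpl never.

(** * Quaternionic orthogonal polynomials *)

Section MonicOrthogonal.
Context {R : realType}.
Local Notation H := (quat R).
Implicit Types (n k l d i : nat) (p q : {poly H}).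

(** The recurrence coefficients of the generalized Hermite polynomials for the weight
    [s^2 exp(-s^2/2)]. *)
Definition jacobi_coef n : nat := (n + (odd n).*2)%N.
Local Notation gam := jacobi_coef.

Fixpoint mop n : {poly H} :=
  if n is m.+1 then
    if m is l.+1 then 'X * mop m + mop l *+ gam m else 'X
  else 1.

Lemma mopS n : mop n.+1 = 'X * mop n + mop n.-1 *+ gam n.
Proof. by case: n => [|n] //=; rewrite mulr1 mulr0n addr0. Qed.

Lemma mop0 : mop 0 = 1. Proof. by []. Qed.

Arguments mop : simpl never.

Lemma size_mop n : size (mop n) = n.+1 /\ mop n \is monic.
Proof.
suff [] : (size (mop n) = n.+1 /\ mop n \is monic) /\
  (size (mop n.+1) = n.+2 /\ mop n.+1 \is monic) by [].
elim: n => [|n [ih1 ih2]].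
  by rewrite mopS mop0 size_poly1 monic1 mulr1 mulr0n addr0 size_polyX monicX.
split; first exact: ih2.
have [s2 m2] := ih2; have [s1 _] := ih1.
have sX : size ('X * mop n.+1) = n.+3.
  by rewrite -commr_polyX size_mulX -?size_poly_eq0 s2.
have lt : (size (mop n *+ gam n.+1)%R < size ('X * mop n.+1)%R)%N.
  by rewrite sX -scaler_nat (leq_ltn_trans (size_scale_leq _ _))// s1.
rewrite mopS /=; split; first by rewrite size_polyDl.
apply/monicP; rewrite lead_coefDl; last exact: lt.
by rewrite -commr_polyX lead_coefMX; apply/monicP.
Qed.

Lemma coef_mopS n i : (mop n.+1)`_i.+1 = (mop n)`_i + (mop n.-1)`_i.+1 *+ gam n.
Proof. by rewrite mopS coefD -commr_polyX coefMX coefMn. Qed.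

Lemma mop_parity n i : odd i != odd n -> (mop n)`_i = 0.
Proof.
suff [] : (forall i, odd i != odd n -> (mop n)`_i = 0) /\
  (forall i, odd i != odd n.+1 -> (mop n.+1)`_i = 0) by move=> + _; exact.
elim: n {i} => [|n [ih1 ih2]].
  split=> [[|i]|[|[|i]]] //=; first by rewrite mop0 coef1.
    by rewrite mopS mop0 mulr1 mulr0n addr0 coefX.
  by rewrite mopS mop0 mulr1 mulr0n addr0 coefX.
split; first exact: ih2.
move=> -[|i] hi.
  rewrite mopS coefD -commr_polyX coefMX coefMn /= add0r ih1 ?mul0rn//.
  by move: hi; rewrite /=; case: (odd n).
rewrite coef_mopS /= ih2 ?ih1 ?mul0rn ?addr0//.
  by move: hi; rewrite /=; case: (odd i); case: (odd n).
by move: hi; rewrite /=; case: (odd i); case: (odd n).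
Qed.

(** The increment of [gam] depends on the parity alone: [3] after an even index, [-1] after an odd
    one. The additive form avoids subtraction in [nat]. *)
Lemma jacobi_coef_diff n i : odd i = odd n -> (gam i.+1 + gam n = gam i + gam n.+1)%N.
Proof. by rewrite /gam /= => ->; lia. Qed.

(* The Dunkl operator [X^i |-> gam i X^(i-1)] lowers the degree: it maps [mop n.+1] to a multiple
   of [mop n]. *)
Lemma coef_mop_lower n i : (mop n.+1)`_i.+1 *+ gam i.+1 = (mop n)`_i *+ gam n.+1.
Proof.
suff [] : (forall i, (mop n.+1)`_i.+1 *+ gam i.+1 = (mop n)`_i *+ gam n.+1) /\
  (forall i, (mop n.+2)`_i.+1 *+ gam i.+1 = (mop n.+1)`_i *+ gam n.+2) by move=> + _; exact.
have base j : (mop 1)`_j.+1 *+ gam j.+1 = (mop 0)`_j *+ gam 1.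
  by rewrite mopS mop0 mulr1 mulr0n addr0 coefX coef1; case: j => [|j] //; rewrite !mul0rn.
have step m : (forall j, (mop m.+1)`_j.+1 *+ gam j.+1 = (mop m)`_j *+ gam m.+1) ->
    (forall j, (mop m)`_j.+1 *+ gam j.+1 = (mop m.-1)`_j *+ gam m) ->
    forall j, (mop m.+2)`_j.+1 *+ gam j.+1 = (mop m.+1)`_j *+ gam m.+2.
  move=> h1 h2 j; rewrite coef_mopS /= mulrnDl -mulrnA mulnC mulrnA h2.
  (* For the wrong parity the coefficients involved vanish; for the right one [jacobi_coef_diff]
     trades [gam j.+1] for [gam j]. *)
  have [par|npar] := eqVneq (odd j) (odd m.+1); last first.
    have -> : (mop m.-1)`_j *+ gam m = 0.
      case: m npar {h1 h2} => [|m] npar; first by rewrite mulr0n.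
      rewrite mop_parity ?mul0rn//.
      by move: npar; rewrite /=; case: (odd j); case: (odd m).
    by rewrite (@mop_parity m.+1 j)// !mul0rn add0r.
  have E : (mop m.+1)`_j *+ gam m.+1 =
      (mop m.+1)`_j *+ gam j + (mop m.-1)`_j *+ gam m *+ gam m.+1.
    case: j par => [|j] par.
      rewrite /gam /= mulr0n add0r -/(gam m.+1) mopS coefD -commr_polyX coefMX coefMn /=.
      by rewrite add0r.
    by rewrite h1 [in LHS]coef_mopS mulrnDl.
  apply: (addrI ((mop m.+1)`_j *+ gam m.+1)).
  rewrite addrA -mulrnDr addnC (jacobi_coef_diff par) mulrnDr addrAC -E.
  by [].
elim: n {i} => [|n [ih1 ih2]]; last by split; [exact: ih2|exact: step].
split; first exact: base.
by apply: step; [exact: base|move=> j; rewrite /gam mulr0n mop0 coef1 mul0rn].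
Qed.

(** The moments satisfy a recursion with the same numbers [gam]: for odd [j] both sides are [0], so
    only [gam j.+1 = j + 3] at even [j] matters. *)
Lemma pure_moment_step j : pure_moment j.+2 = - (gam j.+1)%:R * pure_moment j :> R.
Proof.
rewrite pure_momentSS /gam; case oj: (odd j.+1); last first.
  have -> : pure_moment j = 0 :> R.
    by rewrite -(odd_double_half j); move: oj => /= /negbFE ->; exact: pure_moment_odd.
  by rewrite !mulr0.
by congr (- (_%:R) * _); rewrite /= addn2.
Qed.

(** An integration by parts: [pure_moment_step] moves one factor [z] onto the Dunkl operator, and
    [coef_mop_lower] turns the result into [- gam n.+1] times the pairing with [mop n], which
    cancels the last term of the recurrence. *)
Lemma qform1_mop n : qform 1 (mop n) = (n == 0%N)%:R.
Proof.
case: n => [|n]; first by rewrite mop0 (@qform1l _ _ 1) ?size_poly1// big_ord1 coef1 mulr1 scale1r.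
case: n => [|n].
  rewrite mopS mop0 mulr1 mulr0n addr0 (@qform1l _ _ 2) ?size_polyX//.
  by rewrite !big_ord_recl big_ord0 !coefX /= /pure_moment scale0r mul0r mulr0 !addr0.
rewrite mopS qformDr qformMnr /= (@qform1l _ _ n.+3); last first.
  by apply: leq_trans (size_polyMleq _ _) _; rewrite size_polyX (size_mop n.+1).1.
rewrite (@qform1l _ (mop n) n.+1) ?(size_mop n).1//.
rewrite 2!big_ord_recl -!commr_polyX !coefMX /= mulr0 add0r scale0r mul0r add0r.
rewrite -sumrMnl -big_split /= big1 // => i _.
rewrite coefMX /= /bump /= !add1n pure_moment_step.
rewrite mulNr mulr_natl scaleNr -scalerMnl mulNr mulrnAl -mulrnAr [(0 + _)%N]add0n.
by rewrite coef_mop_lower mulrnAr addNr.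
Qed.

Fixpoint mop_norm n : nat := if n is m.+1 then gam m.+1 * mop_norm m else 1%N.

Lemma mop_normS n : mop_norm n.+1 = (gam n.+1 * mop_norm n)%N.
Proof. by []. Qed.

Arguments mop_norm : simpl never.

Lemma mop_norm_gt0 n : (0 < mop_norm n)%N.
Proof. by elim: n => // n ih; rewrite mop_normS muln_gt0 ih. Qed.

Lemma XmopE n : 'X * mop n = mop n.+1 - mop n.-1 *+ gam n.
Proof. by rewrite mopS addrK. Qed.

Lemma qformMnl p q n : qform (p *+ n) q = qform p q *+ n.
Proof.
elim: n => [|n ih]; last by rewrite !mulrS qformDl ih.
by rewrite !mulr0n qformC qform0r qconj0.
Qed.

(** Moments enter only through the row [k = 0]. The other rows follow from two previous ones by the
    recurrence and the antisymmetry [qformXl]. *)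
Lemma qform_mop k l : qform (mop k) (mop l) = if k == l then (mop_norm k)%:R else 0.
Proof.
have step m : (forall j, qform (mop m) (mop j) = if m == j then (mop_norm m)%:R else 0) ->
    (forall j, qform (mop m.-1) (mop j) *+ gam m = if m == j.+1 then (mop_norm m)%:R else 0) ->
    forall j, qform (mop m.+1) (mop j) = if m.+1 == j then (mop_norm m.+1)%:R else 0.
  move=> h1 h2 j.
  rewrite mopS qformDl qformMnl h2 qformXl XmopE qformDr qformNr qformMnr !h1 opprB subrK.
  case: j => [|j]; first by rewrite mulr0n.
  rewrite eqSS /=; have [->|_] := eqVneq m j; last by rewrite mul0rn.
  by rewrite mop_normS mulnC natrM mulr_natr.
suff [] : (forall l, qform (mop k) (mop l) = if k == l then (mop_norm k)%:R else 0) /\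
  (forall l, qform (mop k.+1) (mop l) = if k.+1 == l then (mop_norm k.+1)%:R else 0) by move=> + _; exact.
elim: k {l} => [|k [ih1 ih2]]; last first.
  split; first exact: ih2.
  apply: step; first exact: ih2.
  move=> j /=; rewrite ih1 eqSS; have [_|_] := eqVneq k j; last by rewrite mul0rn.
  by rewrite mop_normS mulnC natrM mulr_natr.
have base l : qform (mop 0) (mop l) = if 0%N == l then (mop_norm 0)%:R else 0.
  by rewrite qform1_mop eq_sym; case: eqP.
split; first exact: base.
by apply: step => // j; rewrite mulr0n.
Qed.

Lemma qform_mop_lead d q : (size q <= d.+1)%N ->
  qform (mop d) q = (mop_norm d)%:R * q`_d.
Proof.
(* The size bound is separated from [d] for the induction: subtracting the right multiple
   [mop m * c%:P] lowers the size and, unless [m = d], changes neither side. *)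
suff : forall m q, (m <= d.+1)%N -> (size q <= m)%N -> qform (mop d) q = (mop_norm d)%:R * q`_d.
  by move=> h; exact: h.
elim => [|m ih] {}q md qm.
  by move: qm; rewrite size_poly_leq0 => /eqP ->; rewrite qform0r coef0 mulr0.
have [sm mm] := size_mop m.
pose c := q`_m; pose r := q - mop m * c%:P.
have rE : q = r + mop m * c%:P by rewrite /r subrK.
have rm : (size r <= m)%N.
  apply/leq_sizeP => j; rewrite leq_eqVlt => /orP[/eqP <-|mj].
    rewrite /r coefB coefMC; move/monicP : mm; rewrite lead_coefE sm /= => ->.
    by rewrite mul1r subrr.
  by rewrite /r coefB coefMC !nth_default ?sm// ?mul0r ?subrr// (leq_trans qm).
rewrite [in LHS]rE qformDr qformMCr qform_mop (ih r (ltnW md) rm).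
have [dm|dm] := eqVneq d m.
  by rewrite dm (nth_default _ rm) mulr0 add0r.
rewrite mul0r addr0 /r coefB coefMC (nth_default _ (_ : (size (mop m) <= d)%N)) ?mul0r ?subr0//.
by rewrite sm ltn_neqAle eq_sym dm -ltnS.
Qed.

(** The difference [D] of the two polynomials has some degree [d < n], and [P d = mop d] by
    induction. So [D] is orthogonal to [mop d], and by [qform_mop_lead] its leading coefficient
    times a positive integer vanishes. *)
Lemma monic_orthogonal_unique (P : nat -> {poly H}) : monic_orthogonal P ->
  forall n, P n = mop n.
Proof.
move=> [monP orthP] n; elim/ltn_ind: n => n ih.
have [mP sP] := monP n; have [sm mm] := size_mop n.
apply/eqP; rewrite -subr_eq0; apply/negPn/negP => D0.
set D := P n - mop n in D0.
have sD : (size D <= n)%N.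
  apply/leq_sizeP => j; rewrite leq_eqVlt => /orP[/eqP <-|nj].
    rewrite coefB; move/monicP : mm; move/monicP : mP; rewrite !lead_coefE sm sP /= => -> ->.
    by rewrite subrr.
  by rewrite coefB !nth_default ?sm ?sP// subrr.
have d0 : (0 < size D)%N by rewrite lt0n size_poly_eq0.
have dn : ((size D).-1 < n)%N by rewrite prednK.
have : qform (mop (size D).-1) D = 0.
  rewrite /D qformDr qformNr qform_mop -(ih _ dn) ifN ?oppr0 ?addr0; last first.
    by rewrite neq_ltn dn.
  by apply: orthP => e; move: dn; rewrite e ltnn.
rewrite qform_mop_lead ?prednK// -lead_coefE mulr_natl => /eqP.
apply/negP; apply/eqP => h; move/eqP: D0; apply; apply/eqP.
rewrite -lead_coef_eq0; apply/eqP.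
have h1 : (mop_norm (size D).-1)%:R *: lead_coef D = 0 by rewrite scaler_nat.
move: h1 => /eqP; rewrite scaler_eq0 pnatr_eq0 => /orP[|/eqP//].
by rewrite -leqn0 leqNgt mop_norm_gt0.
Qed.

Lemma sqnorm_of_mop n : sqnorm_of mop n = (mop_norm n)%:R.
Proof. by rewrite -[LHS]/(qform _ _) qform_mop eqxx. Qed.

End MonicOrthogonal.

Arguments mop {R} n : simpl never.
Arguments mop_norm n : simpl never.

(** * The kernel in terms of Hermite polynomials *)

Section GeneralizedHermite.
Context {R : realType}.
Implicit Types (n k : nat) (s t : R).
Local Notation gam := jacobi_coef.

(* The real polynomials with [mop n (s u) = genherm n s *: u ^+ n] for pure unit [u]; they are
   orthogonal for the weight [s^2 exp(-s^2/2)] on the line. *)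
Fixpoint genherm n s : R :=
  if n is m.+1 then
    if m is l.+1 then s * genherm m s - (gam m)%:R * genherm l s else s
  else 1.

Lemma genhermS n s : genherm n.+1 s = s * genherm n s - (gam n)%:R * genherm n.-1 s.
Proof. by case: n => [|n] //=; rewrite mulr1 mul0r subr0. Qed.

Lemma genherm0 s : genherm 0 s = 1. Proof. by []. Qed.

Arguments genherm : simpl never.

Lemma genherm_hermite n s :
  if odd n then s ^+ 2 * genherm n s = s * hermite n.+1 s + hermite n s
  else s * genherm n s = hermite n.+1 s.
Proof.
suff [] : (if odd n then s ^+ 2 * genherm n s = s * hermite n.+1 s + hermite n s
  else s * genherm n s = hermite n.+1 s) /\
  (if odd n.+1 then s ^+ 2 * genherm n.+1 s = s * hermite n.+2 s + hermite n.+1 s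
  else s * genherm n.+1 s = hermite n.+2 s) by [].
elim: n => [|n [ih1 ih2]].
  split; first by rewrite /= genherm0 hermite1 mulr1.
  have g0 : gam 0 = 0%N by [].
  rewrite /= genhermS genherm0 g0 mul0r subr0 hermiteS !hermite1 hermite0.
  by ring.
split; first exact: ih2.
rewrite [odd n.+2]/= [odd n.+1]/= negbK in ih2 *; rewrite genhermS /=.
case on: (odd n) ih1 ih2 => /= ih1 ih2.
  have -> : gam n.+1 = n.+1 by rewrite /gam /= on addn0.
  transitivity (s ^+ 2 * (s * genherm n.+1 s) - n.+1%:R * (s ^+ 2 * genherm n s)); first by ring.
  rewrite ih1 ih2 [hermite n.+3 s]hermiteS /= [X in _ = _ + X]hermiteS /=.
  by rewrite -(@natr1 _ n.+1); ring.
have -> : gam n.+1 = n.+3 by rewrite /gam /= on addn2.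
transitivity (s ^+ 2 * genherm n.+1 s - n.+3%:R * (s * genherm n s)); first by ring.
rewrite ih1 ih2 [hermite n.+3 s]hermiteS /=.
by rewrite -(@natr1 _ n.+2); ring.
Qed.

Lemma mop_norm_fact n :
  mop_norm n = (if odd n then n.+2 * n`! else n.+1`!)%N.
Proof.
elim: n => [//|n ih]; rewrite mop_normS ih /gam /=.
by case: (odd n) => /=; rewrite ?factS; lia.
Qed.

Definition radial_term k s t : R := genherm k s * genherm k t / (mop_norm k)%:R.

Let hterm k s t : R := hermite k s * hermite k t / k`!%:R.

Let radial_term_even k s t : ~~ odd k -> s * t * radial_term k s t = hterm k.+1 s t.
Proof.
move=> ek; have := genherm_hermite k s; have := genherm_hermite k t.
rewrite /radial_term /hterm mop_norm_fact (negbTE ek) => <- <-; ring.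
Qed.

(** The point of this form is that the terms divided by [s t] telescope over odd [k]. *)
Let radial_term_odd k s t : odd k -> s != 0 -> t != 0 ->
  s * t * radial_term k s t = hterm k.+1 s t - hterm k.+2 s t / (s * t) + hterm k s t / (s * t).
Proof.
move=> ok s0 t0; have := genherm_hermite k s; have := genherm_hermite k t.
rewrite /radial_term /hterm mop_norm_fact ok => ht hs.
have -> : genherm k s = (s * hermite k.+1 s + hermite k s) / s ^+ 2.
  by rewrite -hs mulrAC mulfV ?mul1r// expf_neq0.
have -> : genherm k t = (t * hermite k.+1 t + hermite k t) / t ^+ 2.
  by rewrite -ht mulrAC mulfV ?mul1r// expf_neq0.
rewrite !(@hermiteS _ k.+1) !factS !natrM /=.
have f0 := factS_neq0 (R := R) k.
have n1 : k.+1%:R != 0 :> R by rewrite pnatr_eq0.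
have n2 : k.+2%:R != 0 :> R by rewrite pnatr_eq0.
rewrite -(@natr1 _ k.+1) in n2 *.
move: (k.+1%:R) n1 n2 (k`!%:R) f0 => a a0 a1 f f0.
by field; rewrite s0 t0 a0 a1 f0.
Qed.

Lemma sum_radial_even n s t :
  s * t * (\sum_(k < n.+1 | ~~ odd k) radial_term k s t) =
  \sum_(k < n.+2 | odd k) hterm k s t.
Proof.
rewrite [in LHS]big_mkcond [in RHS]big_mkcond /=; elim: n => [|n ih].
  by rewrite !big_ord_recr !big_ord0 /= !add0r radial_term_even.
rewrite big_ord_recr mulrDr ih [RHS]big_ord_recr /=; congr (_ + _).
by rewrite negbK; case: (boolP (odd n)) => en; rewrite ?mulr0// radial_term_even //= negbK.
Qed.

(** In the telescoping sum the initial [hterm 1 s t / (s * t)] equals [1] and supplies the missing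
    term of degree [0]. The other end has the degree of the last odd [k] plus two, that is [n + 2]
    or [n + 1]. *)
Lemma sum_radial_odd n s t : s != 0 -> t != 0 ->
  s * t * (\sum_(k < n.+1 | odd k) radial_term k s t) =
  \sum_(k < n.+2 | ~~ odd k) hterm k s t -
  hterm (if odd n then n.+2 else n.+1) s t / (s * t).
Proof.
move=> s0 t0; have st0 : s * t != 0 by rewrite mulf_neq0.
rewrite [in LHS]big_mkcond [in RHS]big_mkcond /=; elim: n => [|n ih].
  rewrite !big_ord_recr !big_ord0 /= !add0r addr0 mulr0 /hterm !hermite1 !hermite0.
  by rewrite !fact0 factS fact0 muln1 !divr1 mul1r mulfV ?subrr.
rewrite big_ord_recr mulrDr ih [in RHS]big_ord_recr /= negbK.
case on: (odd n) => /=; first by rewrite mulr0 !addr0.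
rewrite radial_term_odd /= ?on//; move: (\sum_(_ < _) _) (hterm _ s t) (hterm _ s t) (hterm _ s t).
by move=> S a b c; ring.
Qed.

End GeneralizedHermite.

Section KernelEvaluation.
Context {R : realType}.
Local Notation H := (quat R).
Implicit Types (n k : nat) (s t : R) (u v : H).

Definition even_radial_sum n s t : R := \sum_(k < n.+1 | ~~ odd k) radial_term k s t.

Definition odd_radial_sum n s t : R := \sum_(k < n.+1 | odd k) radial_term k s t.

Lemma even_radial_sumE n s t : s * t * even_radial_sum n s t =
  (hermite_kernel n.+1 s t - hermite_kernel n.+1 s (- t)) / 2.
Proof.
rewrite sum_radial_even hermite_kernelN /hermite_kernel -sumrB mulr_suml big_mkcond /=.
apply: eq_bigr => k _; rewrite -(signr_odd _ k).
by case: (odd k) => /=; rewrite ?expr0 ?expr1; field.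
Qed.

Lemma odd_radial_sumE n s t : s != 0 -> t != 0 -> s * t * odd_radial_sum n s t =
  (hermite_kernel n.+1 s t + hermite_kernel n.+1 s (- t)) / 2 -
  let m := if odd n then n.+2 else n.+1 in
  hermite m s * hermite m t / m`!%:R / (s * t).
Proof.
move=> s0 t0; rewrite sum_radial_odd//; congr (_ - _).
rewrite hermite_kernelN /hermite_kernel -big_split mulr_suml big_mkcond /=.
apply: eq_bigr => k _; rewrite -(signr_odd _ k).
by case: (odd k) => /=; rewrite ?expr0 ?expr1; field.
Qed.

Lemma qconjZ (a : R) (x : H) : qconj (a *: x) = a *: qconj x.
Proof. by case: x => *; congr Quat => /=; ring. Qed.

Lemma S2_pureq u : S2 u -> exists2 x, u = pureq x & qsqnorm u = 1.
Proof.
case: u => a b c d [/= a0 u1]; exists (b, c, d); first by rewrite a0.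
have h : Num.sqrt (qsqnorm (Quat a b c d)) = 1 by exact: u1.
by rewrite -(sqr_sqrtr (qsqnorm_ge0 _)) h expr1n.
Qed.

Lemma S2_conj u : S2 u -> qconj u = - u.
Proof. by move=> /S2_pureq[x -> _]; rewrite qconj_pureq. Qed.

Lemma S2_sqr u : S2 u -> u * u = - 1.
Proof.
move=> /S2_pureq[[[b c] d] ->]; rewrite /qsqnorm /= expr0n /= add0r => h.
by congr Quat => /=; [rewrite -h; ring | ring | ring | ring].
Qed.

Lemma S2_exprSS n u : S2 u -> u ^+ n.+2 = - u ^+ n.
Proof. by move=> hu; rewrite !exprS mulrA S2_sqr// mulN1r. Qed.

(** From [u^2 = -1], which turns the [+ gam] of the recurrence for [mop] into the [- gam] of
    [genherm]. *)
Lemma peval_mop n s u : S2 u -> peval (mop n) (s *: u) = genherm n s *: u ^+ n.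
Proof.
move=> hu; suff [] : (peval (mop n) (s *: u) = genherm n s *: u ^+ n) /\
  (peval (mop n.+1) (s *: u) = genherm n.+1 s *: u ^+ n.+1) by [].
elim: n => [|n [ih1 ih2]].
  have h0 : peval (mop 0) (s *: u) = 1 by rewrite mop0; exact: peval1.
  have h1 : genherm 1 s = s by [].
  split; first by rewrite h0 genherm0 scale1r expr0.
  have m1 : mop 1 = 'X * mop 0 :> {poly H} by rewrite mopS mulr0n addr0.
  rewrite h1 expr1 m1 pevalXM h0 mulr1; reflexivity.
split; first exact: ih2.
have gS : genherm n.+2 s = s * genherm n.+1 s - (jacobi_coef n.+1)%:R * genherm n s by [].
rewrite mopS pevalD pevalXM pevalMn ih1 ih2 gS.
move: (genherm n.+1 s) (genherm n s) (jacobi_coef n.+1) => g1 g0 c.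
rewrite -scalerAl -scalerAr scalerA -exprS (S2_exprSS _ hu) scalerBl (scalerN (_ * g0)) opprK.
by rewrite -(scalerA c%:R) scaler_nat.
Qed.

(** Both [u] and [- v] square to [-1], so raising [k] by two produces two signs that cancel. *)
Lemma S2_expr_conj k u v : S2 u -> S2 v ->
  u ^+ k * qconj (v ^+ k) = if odd k then - (u * v) else 1.
Proof.
move=> hu hv; rewrite qconjX S2_conj//; have hw : S2 (- v).
  case: hv => v0 v1; split; last by rewrite normrN.
  have -> : qre (- v) = - qre v by [].
  by rewrite v0 oppr0.
suff [] : (u ^+ k * (- v) ^+ k = if odd k then - (u * v) else 1) /\
  (u ^+ k.+1 * (- v) ^+ k.+1 = if odd k.+1 then - (u * v) else 1) by [].
elim: k => [|k [ih1 ih2]].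
  split; first by rewrite !expr0 mulr1.
  by rewrite !expr1 mulrN.
split; first exact: ih2.
by rewrite (S2_exprSS _ hu) (S2_exprSS _ hw) mulrNN ih1 [odd k.+2]/= negbK.
Qed.

Lemma quat_divn (x : H) n : (0 < n)%N -> x / n%:R = (n%:R^-1 : R) *: x.
Proof.
move=> n0; have nR : n%:R != 0 :> R by rewrite pnatr_eq0 -lt0n.
have nH : (n%:R : H) = (n%:R : R) *: 1 by rewrite scaler_nat.
have nU : (n%:R : H) \is a GRing.unit.
  apply/unitrP; exists ((n%:R^-1 : R) *: 1); rewrite nH.
  by split; rewrite -scalerAl mul1r scalerA ?mulVf ?mulfV ?scale1r.
apply: (mulIr nU); rewrite mulrVK//.
by rewrite nH -scalerAl -scalerAr mulr1 scalerA mulVf// scale1r.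
Qed.

Lemma qkernel_mop n s t u v : S2 u -> S2 v ->
  qkernel mop n (s *: u) (t *: v) =
  even_radial_sum n s t *: 1 - odd_radial_sum n s t *: (u * v).
Proof.
move=> hu hv; transitivity (\sum_(k < n.+1)
    radial_term k s t *: (if odd k then - (u * v) else 1)).
  apply: eq_bigr => k _.
  rewrite !peval_mop// sqnorm_of_mop quat_divn ?mop_norm_gt0//.
  rewrite qconjZ -scalerAl -scalerAr !scalerA S2_expr_conj//; congr (_ *: _).
  by rewrite /radial_term; ring.
rewrite (bigID (fun k : 'I_n.+1 => odd k)) /= addrC /even_radial_sum /odd_radial_sum.
rewrite !scaler_suml -sumrN; congr (_ + _); apply: eq_bigr => k.
  by move=> /negbTE ->.
by move=> ->; rewrite scalerN.
Qed.

End KernelEvaluation.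

Section RadialLimits.
Context {R : realType}.
Local Notation h0 := (half_moment 0 : R).

Variables (phi sigma tau : R).
Hypothesis phi_itv : 0 < phi < pi / 2.

Let shift (c : R) (N : nat) : R := c / (2 * sin phi ^+ 2) * (1 / N.-1%:R).
Let s N := osc_point N (phi + shift sigma N).
Let t N := osc_point N (phi + shift tau N).
Let e_ (x : R) : R := expR (- (x ^+ 2 / 4)).
Let c0 : R := Num.sqrt (2 * pi).

Lemma sqrt_fgaussM (x y : R) :
  Num.sqrt (fgauss x * fgauss y) = c0^-1 ^+ 3 * (e_ x * e_ y).
Proof.
have ge0 : 0 <= c0^-1 ^+ 3 * (e_ x * e_ y).
  by rewrite !mulr_ge0 ?exprn_ge0 ?invr_ge0 ?sqrtr_ge0 ?expR_ge0.
rewrite -[RHS](ger0_norm ge0) -sqrtr_sqr; congr Num.sqrt.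
have gE z : gauss_weight z = e_ z ^+ 2.
  by rewrite /gauss_weight /e_ [RHS]expr2 -expRD; congr expR; field.
by rewrite !fgaussE !gE; ring.
Qed.

Let weight N : R :=
  2 * Num.sqrt (osc_freq N) / rho (cos phi) * Num.sqrt (fgauss (s N) * fgauss (t N)).

Let sin_phi_gt0 : 0 < sin phi.
Proof. by apply: sin_gt0_pi; move: phi_itv (pi_gt0 R); lra. Qed.

Let cos_phi_gt0 : 0 < cos phi.
Proof. by apply: cos_gt0_pihalf; move: phi_itv (pi_gt0 R); lra. Qed.

Let points_neq0 : \forall N \near \oo, s N != 0 /\ t N != 0.
Proof.
have c4 : 4 * cos phi ^+ 2 != 0 by rewrite mulf_neq0 ?expf_neq0 ?gt_eqF.
have /cvgr_neq0 := osc_points_cvg sigma tau phi_itv.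
move=> /(_ c4); apply: filterS => N; rewrite -/(s N) -/(t N) => st.
by split; apply: contra_neq st => ->; rewrite ?mulr0 !mul0r.
Qed.

Let A := (rho (cos phi))^-1 * c0^-1 ^+ 3.
Let X N := hermite_kernel N (s N) (t N) * (e_ (s N) * e_ (t N)) / Num.sqrt (osc_freq N).
Let Y N := hermite_kernel N (s N) (- t N) * (e_ (s N) * e_ (t N)) / Num.sqrt (osc_freq N).
Let m N := if odd N.-1 then N.+1 else N.
Let Z N := hermite (m N) (s N) * hermite (m N) (t N) / (m N)`!%:R *
  (e_ (s N) * e_ (t N)) / (s N * t N) / Num.sqrt (osc_freq N).

(** Here [rho (cos phi)] is [sin phi / ((2 pi)^2 cos^2 phi)] and [h0^-1 = 2 / sqrt(2 pi)]. The
    remaining [1/2] is this [2] over the [4] of [4 cos^2 phi]. *)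
Let A_limit : A * (4 * cos phi ^+ 2)^-1 * (h0^-1 * sin phi * sinc (tau - sigma)) =
  sinc (tau - sigma) / 2.
Proof.
have c00 : 0 < c0 by rewrite sqrtr_gt0 mulr_gt0// pi_gt0.
have c02 : c0 ^+ 2 = 2 * pi by rewrite sqr_sqrtr// mulr_ge0// pi_ge0.
have sE : Num.sqrt (1 - cos phi ^+ 2) = sin phi.
  by rewrite -sin2cos2 sqrtr_sqr ger0_norm// ltW.
rewrite /A /rho sE half_moment0 -/c0 -c02.
move: c0 c00 (sin phi) sin_phi_gt0 (cos phi) cos_phi_gt0 => c cp a ap b bp.
by field; rewrite !gt_eqF.
Qed.

(** [W] receives what distinguishes the two parities and vanishes in the limit: [- Y] for the even
    sum, [Y - 2 Z] for the odd one, where the boundary term is not halved. *)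
Let combination_cvg (W : nat -> R) (l : R) : W N @[N --> \oo] --> l ->
  A * (s N * t N / osc_freq N)^-1 * (X N + W N) @[N --> \oo] -->
  A * (4 * cos phi ^+ 2)^-1 * (h0^-1 * sin phi * sinc (tau - sigma) + l).
Proof.
move=> Wl; apply: cvgM.
  apply: cvgMl_tmp; apply: cvgV; last exact: osc_points_cvg.
  by rewrite mulf_neq0 ?expf_neq0 ?gt_eqF.
by apply: cvgD; [exact: hermite_kernel_sinc_cvg | exact: Wl].
Qed.

Lemma even_radial_sum_cvg :
  weight N * even_radial_sum N.-1 (s N) (t N) @[N --> \oo] --> sinc (tau - sigma) / 2.
Proof.
have Y0 : - Y N @[N --> \oo] --> (- 0 : R).
  by apply: cvgN; exact: hermite_kernelN_scaled_cvg0.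
have := combination_cvg Y0; rewrite oppr0 addr0 A_limit => lim.
apply: (cvg_near_eq lim); near=> N.
have N0 : (0 < N)%N by near: N; exact: nbhs_infty_gt.
have [s0 t0] : s N != 0 /\ t N != 0 by near: N; exact: points_neq0.
have := even_radial_sumE N.-1 (s N) (t N); rewrite prednK// => /(canRL (mulKf (mulf_neq0 s0 t0))) ->.
rewrite /weight sqrt_fgaussM /A /X /Y.
have nuE := esym (sqr_sqrt_osc_freq (R := R) N); have := sqrt_osc_freq_neq0 (R := R) N.
move: nuE; move: (Num.sqrt _) => r -> r0.
move: (rho (cos phi)) => q; rewrite -/(e_ _).
move: (s N) s0 (t N) t0 (hermite_kernel _ _ _) (hermite_kernel _ _ _) (e_ _) (e_ _)
  => x x0 y y0 k k' a b.
move: (c0^-1) (q^-1) => ci qi.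
by field; rewrite x0 y0 r0.
Unshelve. all: by end_near.
Qed.

Lemma odd_radial_sum_cvg :
  weight N * odd_radial_sum N.-1 (s N) (t N) @[N --> \oo] --> sinc (tau - sigma) / 2.
Proof.
have hm N : m N = N \/ m N = N.+1 by rewrite /m; case: odd; [right | left].
have YZ0 : Y N - 2 * Z N @[N --> \oo] --> (0 - 2 * 0 : R).
  apply: cvgB; first exact: hermite_kernelN_scaled_cvg0.
  by apply: cvgMl_tmp; exact: hermite_edge_scaled_cvg0.
have := combination_cvg YZ0; rewrite mulr0 subr0 addr0 A_limit => lim.
apply: (cvg_near_eq lim); near=> N.
have N0 : (0 < N)%N by near: N; exact: nbhs_infty_gt.
have [s0 t0] : s N != 0 /\ t N != 0 by near: N; exact: points_neq0.
have := odd_radial_sumE N.-1 s0 t0; rewrite prednK// -/(m N).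
move=> /(canRL (mulKf (mulf_neq0 s0 t0))) ->.
rewrite /weight sqrt_fgaussM /A /X /Y /Z.
have nuE := esym (sqr_sqrt_osc_freq (R := R) N); have := sqrt_osc_freq_neq0 (R := R) N.
move: nuE; move: (Num.sqrt _) => r -> r0.
move: (rho (cos phi)) => q; rewrite -/(e_ _).
move: (s N) s0 (t N) t0 (hermite_kernel _ _ _) (hermite_kernel _ _ _)
  (hermite _ _ * _ / _) (e_ _) (e_ _) => x x0 y y0 k k' h a b.
move: (c0^-1) (q^-1) => ci qi.
by field; rewrite x0 y0 r0.
Unshelve. all: by end_near.
Qed.

End RadialLimits.

Unset Implicit Arguments.
Set Strict Implicit.

Theorem mainTheorem15 (R : realType) (P : nat -> {poly quat R})
    (hP : monic_orthogonal P) (eps x0 sigma tau : R) (u v : quat R)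
    (heps : 0 < eps < 1 / 2) (hx0 : eps <= x0 <= 1 - eps)
    (hu : S2 u) (hv : S2 v) :
  rescaled_kernel P n u sigma v tau x0 @[n --> \oo] -->
    sinc (tau - sigma) *: ((1 - u * v) / 2).
Proof.
have x0_itv : -1 <= x0 <= 1 by move: heps hx0; lra.
have cos_phi : cos (acos x0) = x0 by rewrite acosK// in_itv.
have phi_itv : 0 < acos x0 < pi / 2.
  apply/andP; split; first by apply: acos_gt0; move: heps hx0; lra.
  rewrite -ltr_cos ?in_itv /= ?acos_ge0 ?acos_lepi//; last by move: (pi_gt0 R); lra.
  by rewrite cos_phi cos_pihalf; move: heps hx0; lra.
have pE n : P n = mop n by exact: monic_orthogonal_unique.
(* The index shift between the kernel of degree [n] and the Hermite kernel of degree [n + 1]; the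
   limits along [N] are used along [n.+1]. *)
have freqE n : n%:R + 3 / 2 = osc_freq n.+1 :> R.
  by rewrite /osc_freq -(@natr1 _ n); field.
have pointE c n : scaled_point x0 c n =
    osc_point n.+1 (acos x0 + c / (2 * sin (acos x0) ^+ 2) * (1 / n.+1.-1%:R)).
  by rewrite /scaled_point freqE.
pose s n := scaled_point x0 sigma n; pose t n := scaled_point x0 tau n.
pose w n : R := 2 * Num.sqrt (n%:R + 3 / 2) / rho x0 * Num.sqrt (fgauss (s n) * fgauss (t n)).
have even_cvg : w n * even_radial_sum n (s n) (t n) @[n --> \oo] --> sinc (tau - sigma) / 2.
  have := @even_radial_sum_cvg R (acos x0) sigma tau phi_itv.
  rewrite -cvg_shiftS cos_phi => lim; apply: (cvg_near_eq lim); near=> n.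
  by rewrite /w /s /t !pointE freqE.
have odd_cvg : w n * odd_radial_sum n (s n) (t n) @[n --> \oo] --> sinc (tau - sigma) / 2.
  have := @odd_radial_sum_cvg R (acos x0) sigma tau phi_itv.
  rewrite -cvg_shiftS cos_phi => lim; apply: (cvg_near_eq lim); near=> n.
  by rewrite /w /s /t !pointE freqE.
have -> : sinc (tau - sigma) *: ((1 - u * v) / 2) =
    (sinc (tau - sigma) / 2) *: 1 - (sinc (tau - sigma) / 2) *: (u * v).
  by rewrite quat_divn// scalerA scalerBr.
have -> : (fun n => rescaled_kernel P n u sigma v tau x0) = (fun n =>
    (w n * even_radial_sum n (s n) (t n)) *: 1 - (w n * odd_radial_sum n (s n) (t n)) *: (u * v)).
  apply/funext => n; rewrite /rescaled_kernel -/(s n) -/(t n) -/(w n).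
  have -> : qkernel P n = qkernel mop n.
    by apply/funext => x; apply/funext => y; apply: eq_bigr => k _; rewrite /sqnorm_of pE.
  by rewrite qkernel_mop// scalerBr !scalerA.
by apply: cvgB; apply: cvgZr_tmp.
Unshelve. all: by end_near.
Qed.
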